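(* Let $U^n$ be a lightlike hypersurface of the de Sitter space $S^{n+1}_1$. Then $U^n$ is a ruled tangentially degenerate hypersurface (it is ruled by the isotropic straight lines $A_nA_0$, and its tangent hyperplane is constant along each of them), and its rank is equal to the dimension of the submanifold $V\subset Q^n$ described by the point $A_0$ on the hyperquadric $Q^n$, where $A_0$ is the point of tangency of the tangent hyperplane $T_x(U^n)$ with $Q^n$ as $x=A_n$ ranges over $U^n$.
   Context: Let $(\cdot,\cdot)$ be a quadratic form of signature $(n+1,1)$ on $\mathbb{R}^{n+2}$, let $P^{n+1}$ be the associated real projective space, and let $Q^n=\{(x,x)=0\}\subset P^{n+1}$ be the corresponding oval hyperquadric (the absolute). The de Sitter space $S^{n+1}_1$ is identified with the exterior domain $\{(x,x)>0\}$ of $Q^n$ in $P^{n+1}$; with points normalized by $(x,x)=1$, its pseudo-Riemannian metric is $(dx,dx)$, of Lorentzian signature $(n,1)$. A hypersurface $U^n$ ($\dim U^n=n$) of $S^{n+1}_1$ is called lightlike if each of its tangent hyperplanes $\eta=T_x(U^n)$ (a projective hyperplane of $P^{n+1}$ through $x$) is tangent to $Q^n$; write $A_n=x$ and $A_0$ for the point of tangency of $\eta$ with $Q^n$. It is assumed that the entire straight line $A_nA_0$ belongs to $U^n$. A hypersurface is tangentially degenerate if its tangent hyperplane is constant along generators of positive dimension, i.e. if the family of its tangent hyperplanes depends on fewer than $n$ parameters. The rank of a tangentially degenerate hypersurface is the number of parameters on which the family of its tangent hyperplanes depends, i.e. the rank of the map $x\mapsto T_x(U^n)$ into the dual projective space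 (taken constant). All functions are real and differentiable; manifolds are smooth with the possible exception of isolated singular points and singular submanifolds. *)

(* Defs.v *)
From mathcomp Require Import all_boot all_order all_algebra.
From mathcomp Require Import all_classical all_reals all_analysis.

Set Implicit Arguments.
Unset Strict Implicit.
Unset Printing Implicit Defensive.

Import Order.TTheory GRing.Theory Num.Theory.
Import numFieldNormedType.Exports.

Local Open Scope classical_set_scope.
Local Open Scope ring_scope.

(* Points of P^{n+1} are given by their homogeneous coordinate vectors in
   R^{n+2}, so a subset of P^{n+1} is a set of nonzero vectors stable under
   nonzero scaling (a cone).  A subspace of P^{n+1} of projective dimension d
   is given by the set of vectors of the corresponding linear subspace of
   dimension d+1, zero vector included. *)

Section Smooth.
Context {R : realType} {N : nat} {W : normedModType R}.

Fixpoint iter_derive (vs : seq 'rV[R]_N) (f : 'rV[R]_N -> W) : 'rV[R]_N -> W :=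
  if vs is v :: vs' then (fun x => 'D_v (iter_derive vs' f) x) else f.

(* Class C^oo: all iterated directional derivatives exist and are (Frechet)
   differentiable, hence continuous. *)
Definition smooth_on (O : set 'rV[R]_N) (f : 'rV[R]_N -> W) : Prop :=
  forall vs x, O x -> differentiable (iter_derive vs f) x.

End Smooth.

Section Projective.
Context {R : realType} {n : nat}.
Implicit Types (X O : set 'rV[R]_n.+2) (x a v : 'rV[R]_n.+2).

Definition projective_set X : Prop :=
  forall x, X x -> x != 0 /\ forall k : R, k != 0 -> X (k *: x).

(* Near x, X is an embedded C^oo submanifold of P^{n+1} of dimension d: the
   zero set of c = n+1-d functions with independent differentials at x.  As
   R^{n+2} \ {0} -> P^{n+1} is a submersion, this may be tested on cones, the
   codimension being the same. *)
Definition submanifold_at (d : nat) X x : Prop :=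
  exists (c : nat) (O : set 'rV[R]_n.+2) (f : 'I_c -> 'rV[R]_n.+2 -> R^o),
  [/\ (d + c = n.+1)%N,
      X x /\ open_nbhs x O,
      forall i, smooth_on O (f i),
      row_free (\matrix_(i < c, j < n.+2) 'D_(delta_mx 0 j) (f i) x : 'M[R]_(c, n.+2))
    & forall y, O y -> (X y <-> forall i, f i y = 0)].

Definition tangent_space X x : set 'rV[R]_n.+2 :=
  [set v | exists g : R^o -> 'rV[R]_n.+2,
    [/\ g 0 = x, \forall t \near (0 : R^o), X (g t) & is_derive (0 : R^o) 1 g v]].

(* The hyperplane represented by the point xi of the dual projective space. *)
Definition hyperplane (xi : 'rV[R]_n.+2) : set 'rV[R]_n.+2 :=
  [set v | v *m xi^T = 0].

Definition proj_line x a : set 'rV[R]_n.+2 :=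
  [set y | exists s t : R, y = s *: x + t *: a].

(* Hypersurfaces of P^{n+1}, possibly with singularities: the points of U near
   which U is not an embedded smooth hypersurface are singular. *)
Definition regular (U : set 'rV[R]_n.+2) : set 'rV[R]_n.+2 :=
  [set x | submanifold_at n U x].

(* Rank at x of the map y |-> T_y(U) from U to the dual projective space.  In a
   smooth local lift xi of this map, the tangent space of the dual projective
   space is R^{n+2} / <xi x>, so the rank is the dimension of the image of
   T_x(U) under the differential of xi, modulo xi x.  The rows of
   kermx (xi x)^T span T_x(U); its radial direction x is sent into <xi x>, the
   point T_y(U) being constant along k x. *)
Definition gauss_rank_at (U : set 'rV[R]_n.+2) x (r : nat) : Prop :=
  exists (O : set 'rV[R]_n.+2) (xi : 'rV[R]_n.+2 -> 'rV[R]_n.+2),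
  [/\ open_nbhs x O,
      smooth_on O xi,
      forall y, O y -> U y -> xi y != 0 /\ tangent_space U y = hyperplane (xi y)
    & \rank (kermx (xi x)^T *m jacobian xi x + xi x)%MS = r.+1].

Definition gauss_rank (U : set 'rV[R]_n.+2) (r : nat) : Prop :=
  forall x, regular U x -> gauss_rank_at U x r.

Definition tangentially_degenerate (U : set 'rV[R]_n.+2) : Prop :=
  forall x, regular U x -> exists2 r, (r < n)%N & gauss_rank_at U x r.

End Projective.

Section DeSitter.
Context {R : realType} {n : nat}.
Variable B : 'M[R]_n.+2.
Implicit Types (U O : set 'rV[R]_n.+2) (x a : 'rV[R]_n.+2).

Definition lorentzian_form : Prop :=
  B^T = B /\
  exists2 P : 'M[R]_n.+2, P \in unitmx &
    P *m B *m P^T = diag_mx (\row_j (if j == ord_max then -1 else 1)).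

Definition form x a : R := (x *m B *m a^T) 0 0.

Definition absolute : set 'rV[R]_n.+2 := [set a | a != 0 /\ form a a = 0].

Definition de_sitter : set 'rV[R]_n.+2 := [set x | 0 < form x x].

Definition normalize x : 'rV[R]_n.+2 := (Num.sqrt (form x x))^-1 *: x.

(* The line joining x to the point a of the absolute is a null curve of the
   metric (dx, dx), which is computed on points normalized by (x, x) = 1. *)
Definition isotropic_line x a : Prop :=
  forall t : R^o, exists v : 'rV[R]_n.+2,
  [/\ is_derive t 1 (fun s : R^o => normalize (x + s *: a)) v,
      v != 0 & form v v = 0].

Definition hypersurface U : Prop :=
  [/\ U `<=` de_sitter, projective_set U, U !=set0
    & U `<=` closure (regular U)].

(* T_x(U) is tangent to the absolute at a, i.e. x = A_n and a = A_0. *)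
Definition tangency_point U x a : Prop :=
  absolute a /\ tangent_space U x = tangent_space absolute a.

Definition lightlike_hypersurface U : Prop :=
  hypersurface U /\ forall x, regular U x -> exists a, tangency_point U x a.

(* The part of V described by A_0 as x = A_n ranges over U in O; V itself is
   obtained for O = setT. *)
Definition tangency_locus U O : set 'rV[R]_n.+2 :=
  [set a | exists2 x, regular U x /\ O x & tangency_point U x a].

(* A_0 describes a submanifold V of dimension d.  Distant parts of U may be
   sent to pieces of V that cross each other, so this is an immersed
   submanifold: small enough pieces of U describe embedded ones. *)
Definition tangency_locus_dim U (d : nat) : Prop :=
  forall x, regular U x -> forall O', nbhs x O' ->
  exists O, [/\ open_nbhs x O, O `<=` O' &
    forall a, tangency_locus U O a -> submanifold_at d (tangency_locus U O) a].

End DeSitter.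

(* Main.v *)
Require Import Defs.
From mathcomp Require Import all_boot all_order all_algebra.
From mathcomp Require Import all_classical all_reals all_analysis.
From mathcomp Require Import lra ring zify.
Import Order.TTheory GRing.Theory Num.Theory.
Import numFieldNormedType.Exports.
(* Restores the names of [Defs], such as [form], hidden by the imports above. *)
Import Defs.
Local Open Scope classical_set_scope.
Local Open Scope ring_scope.
Set Implicit Arguments.
Unset Strict Implicit.
Unset Printing Implicit Defensive.

(** If the tangent hyperplane of [U] at [x] touches the absolute at [a], then
    [T_x U] is the polar [a^perp] of [a], so [x] is orthogonal to [a] and the
    line [xa] is isotropic.  At another regular point [y] of this line, with
    contact point [b], the line lies in [U], so [a] is tangent to [U] at [y],
    that is, orthogonal to [b]; two orthogonal isotropic vectors of a
    Lorentzian space are proportional, so [T_y U = b^perp = a^perp].  Hence the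
    differential of the Gauss map vanishes, in the dual projective space, on
    the two independent directions [x] and [a], and its rank is less than [n].

    If [f = 0] is a local equation of [U], the Gauss map is lifted by [grad f]
    and the contact point is [A = grad f * B^-1], so the last assertion is the
    constant rank theorem for the image of [A].  Normalize [A] to
    [alpha = A / A_m] and choose [r] linear coordinates [alpha C] independent on
    the image of [T_x U].  The inverse function theorem makes [alpha C] and [f]
    linear.  As the rank is constant, [alpha] is then a function of [alpha C]
    on [f = 0], so the locus of [A] is the cone over a graph. *)

(** * Differentials of functions of several variables *)

Section Differentials.
Context {R : realType}.

(** [g] has at [x] the first-order expansion of [f], so uniqueness of the differential identifies
    ['d g x] with ['d f x]. *)
Lemma near_eq_differentiable (V W : normedModType R) (f g : V -> W) (x : V) :
  (\near x, f x = g x) -> differentiable f x -> differentiable g x.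
Proof.
move=> fg /diff_locallyP[dfc df]; apply/diff_locallyP.
have E : g \o shift x = cst (g x) + 'd f x +o_ 0 id.
  apply/eqaddoP => e e0; move/eqaddoP : df => /(_ e e0).
  have fg0 : \forall h \near (0 : V), f (h + x) = g (h + x).
    by move: fg; rewrite (near_shift 0 x)/= subr0.
  rewrite /= !near_simpl => H; near=> h.
  have fgh : f (h + x) = g (h + x) by near: h.
  have -> : (g \o shift x - (cst (g x) + 'd f x)) h = (f \o shift x - (cst (f x) + 'd f x)) h.
    by rewrite /= !fctE/= fgh (nbhs_singleton fg).
  by near: h.
have E' := diff_unique dfc E.
by split; rewrite E'.
Unshelve. all: by end_near. Qed.

Lemma open_near_eq (V W : normedModType R) (O : set V) (f g : V -> W) (x : V) :
  open O -> (forall y, O y -> f y = g y) -> O x -> \near x, f x = g x.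
Proof. by move=> oO fg Ox; near do apply: fg; exact: open_nbhs_nbhs. 
Unshelve. all: by end_near. Qed.

Lemma diff_row (V : normedModType R) N (f : V -> 'rV[R]_N) x :
  (forall j, differentiable (fun y => f y 0 j : R^o) x) -> differentiable f x.
Proof.
move=> df.
have -> : f = \sum_j (fun y => f y 0 j *: delta_mx 0 j).
  apply/funext => y; rewrite fct_sumE; exact: row_sum_delta.
by apply: differentiable_sum => j; exact: differentiableZl.
Qed.

Lemma diff_coord (V : normedModType R) N (f : V -> 'rV[R]_N) x j :
  differentiable f x -> differentiable (fun y => f y 0 j : R^o) x.
Proof.
by move=> df; apply: (@differentiable_comp _ _ _ _ f (fun v : 'rV[R]_N => v 0 j)) => //;
   exact: differentiable_coord.
Qed.

Lemma diff_coordE (V : normedModType R) N (f : V -> 'rV[R]_N) x j v :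
  differentiable f x -> 'd (fun y => f y 0 j : R^o) x v = ('d f x v) 0 j.
Proof.
move=> df; rewrite -!deriveE//; last exact: diff_coord.
by rewrite derive_mx ?mxE//; exact: diff_derivable.
Qed.

Lemma derive_sum_delta N (W : normedModType R) (f : 'rV[R]_N -> W) x v :
  differentiable f x -> 'D_v f x = \sum_j v 0 j *: 'D_(delta_mx 0 j) f x.
Proof.
move=> df; rewrite deriveE// {1}[v]row_sum_delta linear_sum.
by apply: eq_bigr => j _; rewrite linearZ deriveE.
Qed.

Lemma derive_comp_curve N (W : normedModType R) (f : 'rV[R]_N -> W)
    (g : R^o -> 'rV[R]_N) (t : R^o) v :
  is_derive t 1 g v -> differentiable f (g t) ->
  is_derive t 1 (f \o g) ('D_v f (g t)).
Proof.
move=> [dg <-] df; have /derivable1_diffP dg' := dg.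
have dfg := differentiable_comp dg' df.
split; first exact/derivable1_diffP.
by rewrite deriveE// diff_comp// !deriveE.
Qed.

Lemma is_derive_line (V : normedModType R) (x a : V) (t : R^o) :
  is_derive t 1 (fun s : R^o => x + s *: a) a.
Proof.
have H : is_diff t (fun s : R^o => x + s *: a) (0 + *:%R^~ a).
  exact: is_diffD.
split; first by apply/diff_derivable; exact: ex_diff.
by rewrite deriveE ?diff_val//= ?scale1r; rewrite /GRing.add/= scale1r add0r.
Qed.

Lemma row_neq0 N (v : 'rV[R]_N) : v != 0 -> exists j, v 0 j != 0.
Proof.
move=> v0; apply/existsP; apply: contraNT v0; rewrite negb_exists => /forallP v0.
by apply/eqP/rowP => j; rewrite [RHS]mxE; apply/eqP; have := v0 j; rewrite negbK.
Qed.

Lemma mulmx_delta_col N (u : 'rV[R]_N) m : u *m delta_mx m (0 : 'I_1) = (u 0 m)%:M.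
Proof. by rewrite -colE; apply/matrixP => i j; rewrite !ord1 !mxE eqxx. Qed.

Lemma derive_coord N (y v : 'rV[R]_N) j :
  'D_v (fun z : 'rV[R]_N => z 0 j : R^o) y = v 0 j.
Proof.
have <- : 'D_v (@id 'rV[R]_N) y 0 j = 'D_v (fun z : 'rV[R]_N => z 0 j : R^o) y.
  by rewrite (@derive_mx R _ 1 N id) ?mxE//; exact: derivable_id.
by rewrite derive_id.
Qed.

Lemma is_derive_near N (O : set 'rV[R]_N) (g : R^o -> 'rV[R]_N) (t : R^o) v :
  is_derive t 1 g v -> nbhs (g t) O -> \forall s \near t, O (g s).
Proof.
move=> dg Og; have /derivable1_diffP/differentiable_continuous := @ex_derive _ _ _ _ _ _ _ dg.
exact.
Qed.

End Differentials.

(** * Functions of class C^k: closure under algebraic operations and composition *)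

Section Ck.
Context {R : realType}.

(* [Ck 0] asks for differentiability, not just for continuity. *)
Fixpoint Ck N (W : normedModType R) k (O : set 'rV[R]_N) (f : 'rV[R]_N -> W) : Prop :=
  (forall x, O x -> differentiable f x) /\
  (if k is k'.+1 then forall v, Ck k' O ('D_v f) else True).

Lemma Ck_diff N (W : normedModType R) k (O : set 'rV[R]_N) (f : 'rV[R]_N -> W) x :
  Ck k O f -> O x -> differentiable f x.
Proof. by case: k => [|k] [+ _]; apply. Qed.

(** [iter_derive] applies the head of the list last; the innermost derivative, which [Ck] peels off
    first, is therefore the last entry. *)
Lemma iter_derive_rcons N (W : normedModType R) vs v (f : 'rV[R]_N -> W) :
  iter_derive (rcons vs v) f = iter_derive vs ('D_v f).
Proof. by elim: vs => //= w vs ->. Qed.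

Lemma smooth_onP N (W : normedModType R) (O : set 'rV[R]_N) (f : 'rV[R]_N -> W) :
  smooth_on O f <-> forall k, Ck k O f.
Proof.
split=> [sf k|Cf vs].
  elim: k f sf => [|k IH] f sf; split => //; try exact: (sf [::]).
  by move=> v; apply: (IH ('D_v f)) => vs x Ox; rewrite -iter_derive_rcons; exact: sf.
move: (Cf (size vs)); elim/last_ind: vs f {Cf} => [|vs v IH] f.
  by move=> /Ck_diff.
by rewrite size_rcons iter_derive_rcons => -[_ /(_ v)/IH].
Qed.

Lemma smooth_Ck N (W : normedModType R) k (O : set 'rV[R]_N) (f : 'rV[R]_N -> W) :
  smooth_on O f -> Ck k O f.
Proof. by move/smooth_onP. Qed.

Lemma CkW N (W : normedModType R) k (O : set 'rV[R]_N) (f : 'rV[R]_N -> W) :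
  Ck k.+1 O f -> Ck k O f.
Proof.
by elim: k f => [|k IH] f [df Df]; split => // v; exact/IH/Df.
Qed.

Lemma Ck_sub N (W : normedModType R) k (O O' : set 'rV[R]_N) (f : 'rV[R]_N -> W) :
  O' `<=` O -> Ck k O f -> Ck k O' f.
Proof.
move=> sO; elim: k f => [|k IH] f [df Df]; split => //; try by move=> x /sO/df.
by move=> v; exact/IH/Df.
Qed.

Lemma Ck_ext N (W : normedModType R) k (O : set 'rV[R]_N) (f g : 'rV[R]_N -> W) :
  open O -> (forall x, O x -> f x = g x) -> Ck k O f -> Ck k O g.
Proof.
move=> oO; elim: k f g => [|k IH] f g fg [df Df]; split => //.
- by move=> x Ox; apply: near_eq_differentiable (df x Ox); exact: open_near_eq oO fg Ox.
- by move=> x Ox; apply: near_eq_differentiable (df x Ox); exact: open_near_eq oO fg Ox.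
move=> v; apply: IH (Df v) => x Ox.
by apply: near_eq_derive; exact: open_near_eq oO fg Ox.
Qed.

Section Scalar.
Variables (N : nat) (O : set 'rV[R]_N).
Hypothesis oO : open O.
Implicit Types f g : 'rV[R]_N -> R^o.

Lemma Ck_cst k (c : R^o) : Ck k O (fun=> c).
Proof.
elim: k c => [|k IH] c; split => //; try by move=> x _; exact: differentiable_cst.
move=> v; apply: Ck_ext (IH 0) => // x Ox; rewrite derive_cst//.
Qed.

Lemma CkD k f g : Ck k O f -> Ck k O g -> Ck k O (fun x => f x + g x).
Proof.
elim: k f g => [|k IH] f g [df Df] [dg Dg]; split => //;
  try by move=> x Ox; apply: (@differentiableD _ _ _ f g); [exact: df|exact: dg].
move=> v; apply: Ck_ext (IH _ _ (Df v) (Dg v)) => // x Ox.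
by rewrite (@deriveD _ _ _ f g x v)//; apply: diff_derivable; [exact: df|exact: dg].
Qed.

(** The Leibniz rule mixes derivatives with the functions themselves; [CkW] lowers the order of the
    latter so that induction applies. *)
Lemma CkM k f g : Ck k O f -> Ck k O g -> Ck k O (fun x => f x * g x).
Proof.
elim: k f g => [|k IH] f g Cf Cg; split => //;
  try by move=> x Ox; apply: (@differentiableM _ _ f g x); [exact: (Ck_diff Cf)|exact: (Ck_diff Cg)].
move=> v; have [_ Df] := Cf; have [_ Dg] := Cg.
apply: Ck_ext (CkD (IH _ _ (CkW Cf) (Dg v)) (IH _ _ (CkW Cg) (Df v))) => // x Ox.
by rewrite (@deriveM _ _ f g x v)//; apply: diff_derivable;
   [exact: Ck_diff Cf Ox|exact: Ck_diff Cg Ox].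
Qed.

Lemma CkZ k (c : R) f : Ck k O f -> Ck k O (fun x => c * f x).
Proof. by move=> Cf; apply: (CkM (f := fun=> c)) => //; exact: Ck_cst. Qed.

Lemma CkN k f : Ck k O f -> Ck k O (fun x => - f x).
Proof.
by move=> /(CkZ (-1)); apply: Ck_ext => // x _; rewrite mulN1r.
Qed.

Lemma CkB k f g : Ck k O f -> Ck k O g -> Ck k O (fun x => f x - g x).
Proof. by move=> Cf /CkN; exact: CkD. Qed.

Lemma CkV k f : (forall x, O x -> f x != 0) -> Ck k O f ->
  Ck k O (fun x => (f x)^-1).
Proof.
move=> f0; elim: k f f0 => [|k IH] f f0 Cf; split => //;
  try by move=> x Ox; apply: differentiableV => //; [exact: (Ck_diff Cf)|exact: f0].
move=> v; have [_ Df] := Cf.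
have Ci := IH _ f0 (CkW Cf).
apply: Ck_ext (CkN (CkM (CkM Ci Ci) (Df v))) => // x Ox.
rewrite (@deriveV _ _ f x v) ?f0//; last exact/diff_derivable/(Ck_diff Cf).
by rewrite /GRing.scale/= mulNr -expr2 exprVn.
Qed.

Lemma Ck_sum k (I : Type) (r : seq I) (P : pred I) (f : I -> 'rV[R]_N -> R^o) :
  (forall i, P i -> Ck k O (f i)) -> Ck k O (fun x => \sum_(i <- r | P i) f i x).
Proof.
move=> Cf; elim: r => [|i r IH].
  by apply: Ck_ext (Ck_cst k 0) => // x _; rewrite big_nil.
have [Pi|Pi] := boolP (P i).
  by apply: Ck_ext (CkD (Cf i Pi) IH) => // x _; rewrite big_cons Pi.
by apply: Ck_ext IH => // x _; rewrite big_cons (negPf Pi).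
Qed.

Lemma Ck_prod k (I : Type) (r : seq I) (P : pred I) (f : I -> 'rV[R]_N -> R^o) :
  (forall i, P i -> Ck k O (f i)) -> Ck k O (fun x => \prod_(i <- r | P i) f i x).
Proof.
move=> Cf; elim: r => [|i r IH].
  by apply: Ck_ext (Ck_cst k 1) => // x _; rewrite big_nil.
have [Pi|Pi] := boolP (P i).
  by apply: Ck_ext (CkM (Cf i Pi) IH) => // x _; rewrite big_cons Pi.
by apply: Ck_ext IH => // x _; rewrite big_cons (negPf Pi).
Qed.

Lemma Ck_coord k j : Ck k O (fun x => x 0 j).
Proof.
case: k => [|k]; split => //; try by move=> x _; exact: differentiable_coord.
move=> v; apply: Ck_ext (Ck_cst k (v 0 j)) => // x _.
by rewrite derive_coord.
Qed.

Lemma Ck_det k m (A : 'rV[R]_N -> 'M[R]_m) :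
  (forall i j, Ck k O (fun x => A x i j)) -> Ck k O (fun x => \det (A x)).
Proof.
move=> CA; apply: Ck_sum => s _; apply: CkZ.
by apply: Ck_prod => i _; exact: CA.
Qed.

(** By Cramer's rule the entries are cofactors divided by the determinant. *)
Lemma Ck_invmx k m (A : 'rV[R]_N -> 'M[R]_m) :
  (forall x, O x -> A x \in unitmx) ->
  (forall i j, Ck k O (fun x => A x i j)) ->
  forall i j, Ck k O (fun x => invmx (A x) i j).
Proof.
move=> uA CA i j.
have detV : Ck k O (fun x => (\det (A x))^-1).
  by apply: CkV; [move=> x /uA; rewrite unitmxE unitfE|exact: Ck_det].
have cof : Ck k O (fun x => cofactor (A x) j i).
  apply: CkZ; apply: Ck_det => a b.
  apply: Ck_ext (CA (lift j a) (lift i b)) => // x _; rewrite !mxE//.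
apply: Ck_ext (CkM detV cof) => // x Ox.
by rewrite /invmx uA// !mxE.
Qed.

End Scalar.

Lemma Ck_mulmx N M P k (O : set 'rV[R]_N) (g : 'rV[R]_N -> 'rV[R]_M) (L : 'M[R]_(M, P)) :
  open O -> (forall j, Ck k O (fun y => g y 0 j : R^o)) ->
  forall j, Ck k O (fun y => (g y *m L) 0 j : R^o).
Proof.
move=> oO Cg j; have := @Ck_sum _ O oO k _ (index_enum 'I_M) xpredT _ (fun i _ => CkZ oO (L i j) (Cg i)).
apply: Ck_ext => // y _; rewrite mxE; apply: eq_bigr => i _; exact: mulrC.
Qed.

Lemma derive_comp N M (W : normedModType R) (g : 'rV[R]_N -> 'rV[R]_M) (f : 'rV[R]_M -> W) x v :
  differentiable g x -> differentiable f (g x) ->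
  'D_v (f \o g) x = \sum_j 'D_v (fun y => g y 0 j : R^o) x *: 'D_(delta_mx 0 j) f (g x).
Proof.
move=> dg df; rewrite deriveE; last exact: differentiable_comp.
rewrite diff_comp//= -!deriveE// derive_sum_delta//.
apply: eq_bigr => j _; congr (_ *: _).
by rewrite derive_mx ?mxE//; exact: diff_derivable.
Qed.

(** In the chain rule, each term is a derivative of a coordinate of [g] times a partial derivative
    of [f] composed with [g], to which the induction on the order applies. *)
Lemma Ck_comp N M k (O : set 'rV[R]_N) (O' : set 'rV[R]_M)
    (g : 'rV[R]_N -> 'rV[R]_M) (f : 'rV[R]_M -> R^o) :
  open O -> (forall x, O x -> O' (g x)) ->
  (forall j, Ck k O (fun x => g x 0 j : R^o)) -> Ck k O' f -> Ck k O (f \o g).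
Proof.
move=> oO gO; elim: k f => [|k IH] f Cg Cf.
  split=> // x Ox; apply: differentiable_comp; last exact: Ck_diff Cf (gO _ Ox).
  by apply: diff_row => j; exact: Ck_diff (Cg j) Ox.
have dg x : O x -> differentiable g x.
  by move=> Ox; apply: diff_row => j; exact: Ck_diff (Cg j) Ox.
have df x : O x -> differentiable f (g x) by move=> Ox; exact: Ck_diff Cf (gO _ Ox).
split=> [x Ox|v]; first by apply: differentiable_comp; [exact: dg|exact: df].
have [_ Df] := Cf.
have := @Ck_sum _ O oO k _ (index_enum 'I_M) xpredT
  (fun j x => 'D_v (fun y => g y 0 j : R^o) x * ('D_(delta_mx 0 j) f \o g) x).
move=> /(_ _)/(Ck_ext oO _); apply.
  by move=> x Ox; rewrite derive_comp//; [exact: dg|exact: df].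
move=> j _; apply: CkM => //; first by have [_ /(_ v)] := Cg j.
by apply: IH (Df _) => i; exact/CkW.
Qed.

End Ck.

(** * The inverse function theorem *)

Section RowNorm.
Context {R : realType}.

Lemma ler_norm_coord N (v : 'rV[R]_N) j : `|v 0 j| <= `|v|.
Proof.
by rewrite [leRHS]/Num.Def.normr/= mx_normrE; exact: (le_bigmax _ _ (0, j)).
Qed.

Lemma norm_row_le N (v : 'rV[R]_N) c :
  0 <= c -> (forall j, `|v 0 j| <= c) -> `|v| <= c.
Proof.
move=> c0 vc; rewrite [leLHS]/Num.Def.normr/= mx_normrE bigmax_le// => -[i j] _.
by rewrite ord1.
Qed.

Lemma continuous_mulmxr N M (L : 'M[R]_(N, M)) :
  continuous (mulmxr L : 'rV[R]_N -> 'rV[R]_M).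
Proof.
move=> v; apply: differentiable_continuous; apply: diff_row => j.
suff /(Ck_diff (O := setT)) : Ck 0 setT (fun y : 'rV[R]_N => mulmxr L y 0 j : R^o) by apply.
have := @Ck_sum R N setT openT 0 _ (index_enum 'I_N) xpredT
  (fun i y => L i j * y 0 i : R^o).
move=> /(_ (fun i _ => CkZ openT _ (Ck_coord openT _ _))); apply: Ck_ext; first exact: openT.
by move=> y _; rewrite /= mxE; apply: eq_bigr => i _; rewrite mulrC.
Qed.

Lemma diff_mulmxr N M (L : 'M[R]_(N, M)) v :
  differentiable (mulmxr L : 'rV[R]_N -> 'rV[R]_M) v.
Proof. exact/linear_differentiable/continuous_mulmxr. Qed.

Lemma ball_segment N (x y y' : 'rV[R]_N) r (t : R) :
  ball x r y -> ball x r y' -> 0 <= t <= 1 -> ball x r (y' + t *: (y - y')).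
Proof.
rewrite -ball_normE /ball_/= => xy xy' /andP[t0 t1].
have -> : x - (y' + t *: (y - y')) = t *: (x - y) + (1 - t) *: (x - y').
  by apply/rowP => j; rewrite !mxE; lra.
apply: (le_lt_trans (ler_normD _ _)); rewrite !normrZ ger0_norm// ger0_norm ?subr_ge0//.
have [->|tn0] := eqVneq t 0; first by rewrite mul0r add0r subr0 mul1r.
have t0' : 0 < t by rewrite lt_neqAle eq_sym tn0.
have : t * `|x - y| < t * r by rewrite ltr_pM2l.
have : (1 - t) * `|x - y'| <= (1 - t) * r by rewrite ler_wpM2l ?subr_ge0// ltW.
lra.
Qed.

Lemma mean_value N (f : 'rV[R]_N -> R^o) x r y y' :
  (forall z, ball x r z -> differentiable f z) -> ball x r y -> ball x r y' ->
  exists2 t : R, 0 <= t <= 1 & f y - f y' = 'D_(y - y') f (y' + t *: (y - y')).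
Proof.
move=> df xy xy'.
pose g (t : R^o) : 'rV[R]_N := y' + t *: (y - y').
have gb (t : R) : t \in `[0, 1] -> ball x r (g t).
  by rewrite in_itv/= => t01; exact: ball_segment.
have dfg (t : R) : t \in `[0, 1] -> is_derive (t : R^o) (1 : R^o) (f \o g) ('D_(y - y') f (g t)).
  move=> t01; apply: derive_comp_curve; first exact: is_derive_line.
  exact/df/gb.
have [c c01] := @MVT_segment R (f \o g) (fun t => 'D_(y - y') f (g t)) 0 1 ler01
  (fun t t01 => dfg t (subset_itv_oo_cc t01))
  (derivable_within_continuous (fun t t01 => ex_derive (is_derive := dfg t t01))).
rewrite subr0 mulr1 /= {1 2}/g scale1r scale0r addr0 subrKC => ->.
by exists c => //; move: c01; rewrite in_itv.
Qed.

(** For the maximum norm, the derivative along [y - y'] is a sum of [N] terms, each at most [c]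
    times the norm of [y - y']. *)
Lemma mean_value_le N (f : 'rV[R]_N -> R^o) x r y y' c : 0 <= c ->
  (forall z, ball x r z -> differentiable f z) ->
  (forall z j, ball x r z -> `|'D_(delta_mx 0 j) f z| <= c) ->
  ball x r y -> ball x r y' -> `|f y - f y'| <= N%:R * c * `|y - y'|.
Proof.
move=> c0 df Df xy xy'; have [t t01 ->] := mean_value df xy xy'.
have xz := ball_segment xy xy' t01.
rewrite derive_sum_delta; last exact: df.
apply: (le_trans (ler_norm_sum _ _ _)).
have -> : N%:R * c * `|y - y'| = \sum_(j < N) c * `|y - y'|.
  by rewrite sumr_const card_ord -mulrA mulr_natl.
apply: ler_sum => j _; rewrite normrZ mulrC.
by rewrite ler_pM//; [exact: Df|exact: ler_norm_coord].
Qed.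

End RowNorm.

Section InverseFunction.
Context {R : realType} {N : nat}.
Variables (O : set 'rV[R]_N) (Phi : 'rV[R]_N -> 'rV[R]_N) (x : 'rV[R]_N).
Hypothesis Ox : open_nbhs x O.
Hypothesis smooth_Phi : forall j, smooth_on O (fun y => Phi y 0 j : R^o).
Hypothesis dPhix : forall i j,
  'D_(delta_mx 0 i) (fun y => Phi y 0 j : R^o) x = (i == j)%:R.

Definition jac (y : 'rV[R]_N) : 'M[R]_N :=
  \matrix_(i, j) 'D_(delta_mx 0 i) (fun y => Phi y 0 j : R^o) y.

Let dPhi y : O y -> differentiable Phi y.
Proof. by move=> Oy; apply: diff_row => j; exact: (smooth_Phi j [::]). Qed.

Lemma jacE y v : O y -> 'd Phi y v = v *m jac y.
Proof.
move=> Oy; apply/rowP => j; rewrite -(diff_coordE j v (dPhi Oy)).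
have dj : differentiable (fun y => Phi y 0 j : R^o) y by exact/diff_coord/dPhi.
by rewrite -deriveE// derive_sum_delta// mxE; apply: eq_bigr => i _; rewrite mxE.
Qed.

(** The coordinates of [id - Phi], whose differential vanishes at [x]. *)
Let g j (y : 'rV[R]_N) : R^o := y 0 j - Phi y 0 j.

Let dg j y : O y -> differentiable (g j) y.
Proof.
move=> Oy; apply: differentiableB; first exact: differentiable_coord.
exact/diff_coord/dPhi.
Qed.

Let Dg j y v : O y -> 'D_v (g j) y = v 0 j - 'D_v (fun y => Phi y 0 j : R^o) y.
Proof.
move=> Oy; rewrite (@deriveB _ _ _ (fun y : 'rV[R]_N => y 0 j : R^o)
  (fun y => Phi y 0 j : R^o)); [|exact/diff_derivable/differentiable_coord|
  exact/diff_derivable/diff_coord/dPhi].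
by rewrite derive_coord.
Qed.

(** By continuity the partial derivatives of [id - Phi] stay small near [x]; the mean value
    inequality then makes [id - Phi] a contraction of ratio 1/2. *)
Lemma near_identity : exists2 rho, 0 < rho & [/\ ball x rho `<=` O,
  (forall y y', ball x rho y -> ball x rho y' ->
     `|(y - Phi y) - (y' - Phi y')| <= 2^-1 * `|y - y'|) &
  (forall y, ball x rho y -> jac y \in unitmx)].
Proof.
(* Chosen so that [N * c <= 1/2]; the successor keeps the denominator nonzero when [N = 0]. *)
pose c : R := (2 * N.+1%:R)^-1.
have c0 : 0 < c by rewrite invr_gt0 mulr_gt0.
have Nc : N%:R * c <= 2^-1.
  rewrite /c invfM mulrCA ler_piMr ?invr_ge0//.
  by rewrite ler_pdivrMr// mul1r ler_nat.
have nearx : \forall y \near x, O y /\ forall i j, `|'D_(delta_mx 0 i) (g j) y| <= c.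
  have nO : \near x, O x by exact: open_nbhs_nbhs.
  pose P (i j : 'I_N) : set 'rV[R]_N :=
    [set y | `|(i == j)%:R - 'D_(delta_mx 0 i) (fun y => Phi y 0 j : R^o) y| < c].
  have nD : \forall y \near x, forall i j, P i j y.
    apply: (@filter_forall _ _ (fun i => [set y | forall j, P i j y]) (nbhs x) (nbhs_filter x)) => i.
    apply: (@filter_forall _ _ (P i) (nbhs x) (nbhs_filter x)) => j.
    have : {for x, continuous ('D_(delta_mx 0 i) (fun y => Phi y 0 j : R^o))}.
      apply: differentiable_continuous.
      by apply: (smooth_Phi j [:: delta_mx 0 i]); case: Ox.
    by move=> /cvgrPdist_lt/(_ _ c0); rewrite dPhix.
  near=> y; split; first by near: y.
  move=> i j; rewrite Dg; last by near: y.
  rewrite mxE eqxx/= eq_sym ltW//; move: i j; near: y; exact: nD.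
have /nbhs_ballP[rho rho0 Hrho] := nearx => {nearx}.
exists rho => //.
have rO : ball x rho `<=` O by move=> y /Hrho[].
have Dgc j z : ball x rho z -> forall i, `|'D_(delta_mx 0 i) (g j) z| <= c.
  by move=> /Hrho[_ +] i; exact.
split=> //.
  move=> y y' xy xy'; apply: norm_row_le; first by rewrite mulr_ge0.
  move=> j; rewrite !mxE.
  have /le_trans := @mean_value_le R N (g j) x rho y y' c (ltW c0)
    (fun z xz => dg j (rO _ xz)) (fun z i xz => Dgc j z xz i) xy xy'.
  by apply; rewrite ler_wpM2r.
move=> y xy; have Oy := rO _ xy.
rewrite -row_free_unit -kermx_eq0; apply/eqP/row_matrixP => i; rewrite row0.
set v := row i _.
(* On the kernel of [jac y] the derivative of [id - Phi] along [v] is [v] itself, so the norm of [v]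
   is at most half of itself. *)
have vJ : v *m jac y = 0 by rewrite -row_mul mulmx_ker row0.
have : `|v| <= 2^-1 * `|v|.
  apply: norm_row_le => [|j]; first by rewrite mulr_ge0.
  have <- : 'D_v (g j) y = v 0 j.
    rewrite Dg// deriveE; last exact/diff_coord/dPhi.
    by rewrite diff_coordE ?jacE ?vJ ?mxE ?subr0//; exact: dPhi.
  rewrite derive_sum_delta; last exact: dg.
  apply: (le_trans (ler_norm_sum _ _ _)).
  apply: (@le_trans _ _ (N%:R * c * `|v|)); last by rewrite ler_wpM2r.
  have -> : N%:R * c * `|v| = \sum_(k < N) c * `|v|.
    by rewrite sumr_const card_ord -mulrA mulr_natl.
  apply: ler_sum => k _; rewrite normrZ mulrC.
  by rewrite ler_pM//; [exact: Dgc|exact: ler_norm_coord].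
move=> vv; apply/eqP; rewrite -normr_eq0; apply/eqP/le_anti.
rewrite normr_ge0 andbT; lra.
Unshelve. all: by end_near. Qed.

(** Smoothness of the inverse is stated through composites [h \o Psi], the form in which the
    induction on the order runs; coordinate functions [h] give the smoothness of [Psi]. *)
Theorem inverse_function : exists e (Psi : 'rV[R]_N -> 'rV[R]_N) (O1 : set 'rV[R]_N),
  let W := ball (Phi x) e in
  [/\ 0 < e, open_nbhs x O1 /\ O1 `<=` O,
      (forall y, O1 y -> W (Phi y) /\ Psi (Phi y) = y),
      (forall z, W z -> O1 (Psi z) /\ Phi (Psi z) = z) &
      (forall h : 'rV[R]_N -> R^o, smooth_on O h -> smooth_on W (h \o Psi))].
Proof.
have [rho rho0 [rO lip unitJ]] := near_identity.
(* With this radius, [T] below sends the closed ball of radius [rho / 2] into its interior: a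
   distance below [rho / 4] from [z] and at most [rho / 4] from the contraction. *)
pose e := rho / 4; have e0 : 0 < e by rewrite divr_gt0.
have rho20 : 0 < rho / 2 by rewrite divr_gt0.
pose W := ball (Phi x) e.
pose B := ball x (rho / 2).
have Bsub : B `<=` ball x rho by apply: le_ball; lra.
have inj y y' : ball x rho y -> ball x rho y' ->
    `|y - y'| <= 2 * `|Phi y - Phi y'|.
  move=> xy xy'; have := lip _ _ xy xy'.
  have -> : y - Phi y - (y' - Phi y') = (y - y') - (Phi y - Phi y').
    by apply/rowP => j; rewrite !mxE; ring.
  have := lerB_dist (y - y') (Phi y - Phi y').
  lra.
have surj z : W z -> exists y, B y /\ Phi y = z.
  move=> Wz.
  (* The residual [z - Phi y], minimal at some [y] of the closed ball, would be halved at [T y]. *)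
  pose T y := z + (y - Phi y).
  have TB y : `|x - y| <= rho / 2 -> `|x - T y| < rho / 2.
    move=> xy; have xy' : ball x rho y.
      by rewrite -ball_normE /ball_/=; lra.
    have := lip _ _ (ballxx x rho0) xy'.
    have -> : x - T y = (Phi x - z) + (x - Phi x - (y - Phi y)).
      by apply/rowP => j; rewrite !mxE; ring.
    move: Wz; rewrite /W -ball_normE /ball_/=.
    have := ler_normD (Phi x - z) (x - Phi x - (y - Phi y)).
    rewrite /e; lra.
  pose A := closed_ball_ Num.Def.normr x (rho / 2).
  have Ax : A x by rewrite /A /closed_ball_/= subrr normr0 ltW.
  have cA : compact A.
    apply: bounded_closed_compact; last exact: closed_closed_ball_.
    exists (`|x| + rho / 2); split; first exact: num_real.
    move=> M xM y; rewrite /A /closed_ball_/= => xy.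
    have := ler_normB x (x - y); rewrite opprB addrCA subrr addr0; lra.
  have cf : {within A, continuous (fun y => `|Phi y - z| : R)}.
    apply: continuous_in_subspaceT => y; rewrite inE /A /closed_ball_/= => xy.
    apply: continuous_comp; last exact: norm_continuous.
    apply: continuousB; last exact: cst_continuous.
    apply/differentiable_continuous/dPhi/rO.
    by rewrite -ball_normE /ball_/=; lra.
  have [y yA ymin] := EVT_min_rV (ex_intro _ x Ax) cA cf.
  rewrite inE in yA.
  have Ty := TB y yA.
  have := ymin (T y); rewrite inE /A /closed_ball_/= => /(_ (ltW Ty)).
  have xy : ball x rho y.
    by move: yA; rewrite -ball_normE /ball_ /A /closed_ball_/=; lra.
  have xTy : ball x rho (T y) by rewrite -ball_normE /ball_/=; lra.
  have := lip _ _ xTy xy.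
  have -> : T y - Phi (T y) - (y - Phi y) = z - Phi (T y).
    by apply/rowP => j; rewrite !mxE; ring.
  have -> : T y - y = z - Phi y by apply/rowP => j; rewrite !mxE; ring.
  rewrite (distrC z) (distrC z (Phi y)) => H1 H2.
  have : `|Phi y - z| <= 0 by lra.
  rewrite normr_le0 subr_eq0 => /eqP Py.
  exists y; split => //.
  have -> : y = T y by rewrite /T Py subrKC.
  by rewrite /B -ball_normE.
(* The preimage in [B], unique by [inj]; [x] is a default value where no preimage exists. *)
pose Psi z := xget x [set y | B y /\ Phi y = z].
have PsiP z : W z -> B (Psi z) /\ Phi (Psi z) = z by move=> /surj; exact: xgetPex.
have lipPsi z z' : W z -> W z' -> `|Psi z - Psi z'| <= 2 * `|z - z'|.
  move=> /PsiP[Bz Ez] /PsiP[Bz' Ez'].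
  by rewrite -{2}Ez -{2}Ez'; apply: inj; exact: Bsub.
have oW : open W by exact: ball_open.
pose L y := invmx (jac y).
(* The increment [u] of [Psi] satisfies [h = u * jac + o(u)], and [u = O(h)] by [lipPsi];
   multiplying by the inverse of [jac] gives the expansion of [Psi]. *)
have dPsi z : W z -> is_diff z Psi (mulmxr (L (Psi z))).
  move=> Wz; have [Bz Ez] := PsiP _ Wz.
  have Oz := rO _ (Bsub _ Bz).
  pose dl : {linear 'rV[R]_N -> 'rV[R]_N} := mulmxr (L (Psi z)).
  have cL : continuous dl := @continuous_mulmxr _ _ _ (L (Psi z)).
  have [k k0 Lk] := linear_lipschitz cL.
  have E : Psi \o shift z = cst (Psi z) + dl +o_ 0 id.
    apply/eqaddoP => eps eps0.
    (* Here [k] is a Lipschitz constant of the inverse differential and 2 is that of [Psi]. *)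
    have e'0 : 0 < eps / (2 * k) by rewrite divr_gt0// mulr_gt0.
    have /eqaddoP/(_ _ e'0)/= /nbhs_ballP[d d0 Hd] := diff_locally (dPhi Oz).
    near=> h.
    have Wzh : W (h + z).
      near: h; have : \near z, W z by exact: open_nbhs_nbhs.
      by rewrite (near_shift 0 z)/= subr0.
    have hd : 2 * `|h| < d.
      near: h; apply/nbhs_ballP; exists (d / 2); first by rewrite /= divr_gt0.
      by move=> h /=; rewrite -ball_normE /ball_/=; rewrite sub0r normrN; lra.
    have [Bzh Ezh] := PsiP _ Wzh.
    set u := Psi (h + z) - Psi z.
    have uh : `|u| <= 2 * `|h| by rewrite -[h in leRHS](addrK z); exact: lipPsi.
    have /Hd : ball 0 d u by rewrite -ball_normE /ball_/= sub0r normrN; lra.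
    rewrite /= !fctE/= subrK Ezh Ez jacE// opprD addrA addrK => Hu.
    have -> : Psi (h + z) - (Psi z + h *m L (Psi z)) = - mulmxr (L (Psi z)) (h - u *m jac (Psi z)).
      by rewrite /= mulmxBl mulmxK ?unitJ//; [rewrite /u opprB opprD addrA|exact: Bsub].
    rewrite normrN; apply: (le_trans (Lk _)).
    have /(ler_wpM2l (ltW k0)) := Hu.
    have /(ler_wpM2l (ltW (mulr_gt0 k0 e'0))) := uh.
    have -> : k * (eps / (2 * k)) * (2 * `|h|) = eps * `|h|.
      by field; rewrite gt_eqF.
    rewrite -mulrA; lra.
  apply: DiffDef; last exact: diff_unique.
  by apply/diff_locallyP; split; rewrite (diff_unique cL E).
exists e, Psi, (B `&` Phi @^-1` W).
split => //=.
- split; last by move=> y [/Bsub/rO].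
  split; last by split; exact: ballxx.
  rewrite openE => y [By Wy]; apply: filterI.
    by apply: open_nbhs_nbhs; split => //; exact: ball_open.
  apply: (differentiable_continuous (dPhi (rO _ (Bsub _ By)))).
  by apply: open_nbhs_nbhs.
- move=> y [By Wy]; split => //.
  have [By' Ey'] := PsiP _ Wy.
  apply/eqP; rewrite -subr_eq0 -normr_le0.
  have := inj _ _ (Bsub _ By') (Bsub _ By).
  by rewrite Ey' subrr normr0 mulr0.
- by move=> z Wz; have [Bz Ez] := PsiP _ Wz; split => //; split => //; rewrite /= Ez.
move=> h sh; apply/smooth_onP => k.
have CB (f : 'rV[R]_N -> R^o) : smooth_on O f -> smooth_on (ball x rho) f.
  by move=> sf vs y /rO; exact: sf.
move: (CB _ sh) => {CB}{}sh.
have sPhi j k' : Ck k' (ball x rho) (fun y => Phi y 0 j : R^o).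
  by move: k'; apply/smooth_onP => vs y /rO; exact: smooth_Phi.
have oB : open (ball x rho) by exact: ball_open.
elim: k h sh => [|k IH] h sh; split => //.
- move=> z Wz; have [Bz _] := PsiP _ Wz; apply: differentiable_comp.
    by have [] := dPsi _ Wz.
  by apply: (sh [::]); exact: Bsub.
- move=> z Wz; have [Bz _] := PsiP _ Wz; apply: differentiable_comp.
    by have [] := dPsi _ Wz.
  by apply: (sh [::]); exact: Bsub.
move=> v.
(* The derivative of [h \o Psi] along [v] is [Dh \o Psi], with [Dh] again smooth: the induction on
   the order is over all smooth [h]. *)
pose Dh (y : 'rV[R]_N) : R^o :=
  \sum_j (\sum_i v 0 i * L y i j) * 'D_(delta_mx 0 j) h y.
have sDh : smooth_on (ball x rho) Dh.
  apply/smooth_onP => k'; apply: Ck_sum => // j _; apply: CkM => //.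
    apply: Ck_sum => // i _; apply: CkZ => //.
    apply: Ck_invmx => // a b; have [_ /(_ (delta_mx 0 a))] := sPhi b k'.+1.
    by apply: Ck_ext => // y _; rewrite mxE.
  by have [_] := (@smooth_onP R N _ (ball x rho) h).1 sh k'.+1; exact.
apply: Ck_ext (IH _ sDh) => // z Wz; have [Bz _] := PsiP _ Wz.
have dz := dPsi _ Wz.
rewrite derive_comp//; last by apply: (sh [::]); exact: Bsub.
apply: eq_bigr => j _; congr (_ * _).
rewrite deriveE; last exact/diff_coord/ex_diff.
rewrite diff_coordE; last exact: ex_diff.
by rewrite diff_val/= mxE.
Unshelve. all: by end_near. Qed.

End InverseFunction.

(** * The constant rank theorem *)

Section LinearAlgebra.
Context {F : fieldType}.

(** In a relation [C Z1 + e Z2 = 0] between the columns, multiplying by [X] removes [e]; as [X C]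
    has independent columns, [Z1 = 0], and then [Z2 = 0]. *)
Lemma row_full_row_mx p N r (X : 'M[F]_(p, N)) (C : 'M[F]_(N, r)) (e : 'cV[F]_N) :
  \rank (X *m C) = r -> X *m e = 0 -> e != 0 -> row_full (row_mx C e).
Proof.
move=> rXC Xe e0; rewrite -cokermx_eq0; set Z := cokermx _.
have : row_mx C e *m Z = 0 by exact: mulmx_coker.
rewrite -[Z]vsubmxK mul_row_col => CZ.
have XCfull : row_full (X *m C) by rewrite /row_full rXC.
have Z1 : usubmx Z = 0.
  rewrite -[LHS]mul1mx -(mulVpmx XCfull) -[LHS]mulmxA -(mulmxA X C).
  by rewrite (canRL (addrK _) CZ) sub0r mulmxN mulmxA Xe mul0mx oppr0 mulmx0.
move: CZ; rewrite Z1 mulmx0 add0r => eZ2.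
have Z2 : dsubmx Z = 0.
  apply/rowP => k; rewrite [RHS]mxE.
  have [i ei] : exists i, e i 0 != 0.
    apply/existsP; apply: contraNT e0; rewrite negb_exists => /forallP e0.
    by apply/eqP/colP => i; rewrite [RHS]mxE; apply/eqP; have := e0 i; rewrite negbK.
  have /matrixP/(_ i k) := eZ2; rewrite mxE big_ord1 [RHS]mxE => /eqP.
  by rewrite mulf_eq0 (negPf ei)/= => /eqP.
by rewrite Z2 col_mx0.
Qed.

(** [C] is a right inverse of the row base, so that [M *m C] is the column base. It supplies the
    linear coordinates independent on an image. *)
Lemma exists_full_rank_mul N p r (M : 'M[F]_(p, N)) :
  \rank M = r -> exists C : 'M[F]_(N, r), \rank (M *m C) = r.
Proof.
move=> <-; exists (pinvmx (row_base M)).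
have rf : row_free (row_base M) by exact: row_base_free.
have := congr1 (mulmx^~ (pinvmx (row_base M))) (mulmx_base M).
rewrite /= -mulmxA mulmxVp// mulmx1 => <-; exact/eqP/col_base_full.
Qed.

Lemma mulmx_inj_rank N p r (X : 'M[F]_(p, N)) (C : 'M[F]_(N, r)) (u : 'rV[F]_N) :
  \rank (X *m C) = \rank X -> (u <= X)%MS -> u *m C = 0 -> u = 0.
Proof.
move=> rXC uX uC; have := mxrank_mul_ker X C; rewrite rXC => /eqP.
rewrite -[X in _ == X]addn0 eqn_add2l mxrank_eq0 => /eqP XC0.
apply/eqP; rewrite -submx0 -XC0 sub_capmx uX/=; exact/sub_kermxP.
Qed.

(** To be read with [JP], [JS], [J] the Jacobians of [Phi], [Psi], [alpha] and [xi], [g] the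
    gradients of [f] at the base point and at a nearby one. The vector [v *m JS] is tangent to the
    level set of [f] and killed by [J *m C]; [C] being injective on the image of the tangent space,
    [J] kills it too. *)
Lemma fibre_linear N r (xi g : 'rV[F]_N) (D1 C : 'M[F]_(N, r))
    (J JP JS : 'M[F]_N) (v : 'rV[F]_N) :
  JS *m JP = 1%:M -> JP *m xi^T = g^T -> JP *m D1 = J *m C ->
  \rank (kermx xi^T *m D1) = r -> \rank (kermx g^T *m J) = r ->
  v *m D1 = 0 -> v *m xi^T = 0 -> v *m JS *m J = 0.
Proof.
move=> JSP JPxi JPD1 rkx rKJ vD1 vxi; set K := kermx g^T.
have rKJC : \rank (K *m J *m C) = \rank (K *m J).
  apply/eqP; rewrite eqn_leq mxrankM_maxl/= rKJ -{1}rkx.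
  have -> : K *m J *m C = K *m JP *m D1 by rewrite -mulmxA -JPD1 mulmxA.
  apply: mxrankS; apply: submxMr.
  rewrite -[kermx xi^T]mulmx1 -JSP mulmxA; apply: submxMr.
  by rewrite sub_kermx -JPxi -mulmxA (mulmxA JS) JSP mul1mx mulmx_ker.
apply: (mulmx_inj_rank rKJC).
  apply: submxMr; rewrite sub_kermx -JPxi -mulmxA (mulmxA JS) JSP mul1mx; exact/eqP.
by rewrite -mulmxA -JPD1 -mulmxA (mulmxA JS) JSP mul1mx.
Qed.

End LinearAlgebra.

(** * Gradients, Jacobians and the affine chart of projective space *)

Section Jacobian.
Context {R : realType}.

Definition grad N (f : 'rV[R]_N -> R^o) (y : 'rV[R]_N) : 'rV[R]_N :=
  \row_j 'D_(delta_mx 0 j) f y.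

Lemma diff_grad N (f : 'rV[R]_N -> R^o) y v : differentiable f y ->
  'D_v f y = (v *m (grad f y)^T) 0 0.
Proof.
by move=> df; rewrite derive_sum_delta// mxE; apply: eq_bigr => j _; rewrite !mxE.
Qed.

Lemma jacobian_mulmxr N M P (f : 'rV[R]_N -> 'rV[R]_M) (L : 'M[R]_(M, P)) y :
  differentiable f y -> jacobian (fun z => f z *m L) y = jacobian f y *m L.
Proof.
move=> df; apply/row_matrixP => i; rewrite !rowE.
rewrite mul_rV_lin1 (_ : (fun z => _) = mulmxr L \o f)// diff_comp//; last exact: diff_mulmxr.
by rewrite /= diff_lin/=; [rewrite mulmxA mul_rV_lin1|exact: continuous_mulmxr].
Qed.

Lemma near_eq_jacobian N M (f g : 'rV[R]_N -> 'rV[R]_M) y :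
  (\near y, f y = g y) -> differentiable f y -> jacobian f y = jacobian g y.
Proof.
move=> fg df; have dg := near_eq_differentiable fg df.
apply/row_matrixP => i; rewrite [LHS]rowE [RHS]rowE.
rewrite -[LHS]deriveEjacobian// -[RHS]deriveEjacobian//; exact: near_eq_derive.
Qed.

Lemma jacobian_comp N M P (f : 'rV[R]_N -> 'rV[R]_M) (g : 'rV[R]_M -> 'rV[R]_P) y :
  differentiable f y -> differentiable g (f y) ->
  jacobian (g \o f) y = jacobian f y *m jacobian g (f y).
Proof.
move=> df dg; apply/row_matrixP => i; rewrite !rowE mulmxA.
by rewrite !mul_rV_lin1 diff_comp.
Qed.

Lemma jacobian_id N (y : 'rV[R]_N) : jacobian id y = 1%:M.
Proof.
by apply/row_matrixP => i; rewrite !rowE mul_rV_lin1 diff_val mulmx1.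
Qed.

Lemma jacobian_scalar N (f : 'rV[R]_N -> R^o) y :
  differentiable f y ->
  jacobian (fun z => (f z)%:M : 'rV[R]_1) y = (grad f y)^T.
Proof.
move=> df.
have dM : differentiable (fun z => (f z)%:M : 'rV[R]_1) y.
  by apply: diff_row => j; apply: near_eq_differentiable df; near=> z;
     rewrite ord1 mxE eqxx.
apply/row_matrixP => i; rewrite [LHS]rowE -[LHS]deriveEjacobian//.
rewrite [LHS]derive_mx; last exact: diff_derivable.
apply/rowP => j; rewrite (ord1 j) [LHS]mxE [RHS]mxE [RHS]mxE [RHS]mxE.
have E : (fun z : 'rV[R]_N => ((f z)%:M : 'rV[R]_1) 0 0 : R^o) = f by apply/funext => z; rewrite mxE eqxx.
by rewrite [X in derive X _ _]E.
Unshelve. all: by end_near. Qed.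

Lemma smooth_row_diff N M (O : set 'rV[R]_N) (f : 'rV[R]_N -> 'rV[R]_M) y :
  (forall j, smooth_on O (fun z => f z 0 j : R^o)) -> O y -> differentiable f y.
Proof. by move=> sf Oy; apply: diff_row => j; exact: (sf j [::]). Qed.

(** The projective point [A y] read in the affine chart where the [m]-th coordinate is 1. *)
Definition chart N (m : 'I_N) (A : 'rV[R]_N -> 'rV[R]_N) y : 'rV[R]_N :=
  (A y 0 m)^-1 *: A y.

Lemma chart_m N (m : 'I_N) (A : 'rV[R]_N -> 'rV[R]_N) y :
  A y 0 m != 0 -> chart m A y 0 m = 1.
Proof. by move=> Am; rewrite mxE mulVf. Qed.

Lemma smooth_chart N (m : 'I_N) (A : 'rV[R]_N -> 'rV[R]_N) (O : set 'rV[R]_N) :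
  open O -> (forall j, smooth_on O (fun y => A y 0 j : R^o)) ->
  (forall y, O y -> A y 0 m != 0) ->
  forall j, smooth_on O (fun y => chart m A y 0 j : R^o).
Proof.
move=> oO sA Am j; apply/smooth_onP => k.
have CA i : Ck k O (fun y => A y 0 i : R^o) by move: k; apply/smooth_onP.
by apply: Ck_ext (CkM oO (CkV oO Am (CA m)) (CA j)) => // y _; rewrite !mxE.
Qed.

(** The chart divides out the line spanned by [A y], which accounts for the drop from [r.+1] to
    [r]. *)
Lemma rank_chart N (m : 'I_N) (A : 'rV[R]_N -> 'rV[R]_N) y p (K : 'M[R]_(p, N)) r :
  differentiable A y -> A y 0 m != 0 ->
  \rank (K *m jacobian A y + A y)%MS = r.+1 ->
  \rank (K *m jacobian (chart m A) y) = r.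
Proof.
move=> dA Am rA; set a := A y 0 m.
(* [P] is the differential of [u |-> u / u_m] at [A y]; its kernel is spanned by [A y]. *)
pose P : 'M[R]_N := a^-1 *: (1%:M - a^-1 *: (delta_mx m (0 : 'I_1) *m A y)).
have PE u : u *m P = a^-1 *: (u - (a^-1 * u 0 m) *: A y).
  rewrite /P -scalemxAr mulmxBr mulmx1 -scalemxAr mulmxA; congr (_ *: (_ - _)).
  by rewrite mulmx_delta_col mul_scalar_mx scalerA.
have JP : jacobian (chart m A) y = jacobian A y *m P.
  have dj j : differentiable (fun z => A z 0 j : R^o) y by exact: diff_coord.
  have dV : differentiable (fun z => (A z 0 m)^-1 : R^o) y by exact: differentiableV.
  have dc : differentiable (chart m A) y.
    apply: diff_row => j; have := differentiableM dV (dj j).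
    by congr (differentiable _ _); apply/funext => z; rewrite mxE.
  have DA v j : ('D_v A y) 0 j = 'D_v (fun z => A z 0 j : R^o) y.
    by rewrite derive_mx ?mxE//; exact: diff_derivable.
  apply/row_matrixP => i; rewrite [LHS]rowE [RHS]rowE mulmxA.
  rewrite -[LHS]deriveEjacobian// -[X in X *m P]deriveEjacobian// PE.
  rewrite [LHS]derive_mx; last exact: diff_derivable.
  apply/rowP => j; rewrite !mxE !DA.
  have -> : (fun z => chart m A z 0 j : R^o) = (fun z => (A z 0 m)^-1 : R^o) * (fun z => A z 0 j : R^o).
    by apply/funext => z; rewrite mxE.
  rewrite deriveM; [|exact: diff_derivable|exact: diff_derivable].
  rewrite (deriveV (f := fun z => A z 0 m : R^o)) //; last exact: diff_derivable.
  by rewrite /GRing.scale/= -/a; field.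
have AyP : A y *m P = 0.
  by rewrite PE mulVf// scale1r subrr scaler0.
have kerP : (kermx P <= A y)%MS.
  apply/rV_subP => u /sub_kermxP; rewrite PE => /eqP.
  rewrite scaler_eq0 invr_eq0 (negPf Am)/= subr_eq0 => /eqP ->.
  exact: scalemx_sub.
have Ay0 : A y != 0 by apply: contraNneq Am => ->; rewrite mxE.
have := mxrank_mul_ker (K *m jacobian A y + A y)%MS P.
have -> : \rank ((K *m jacobian A y + A y)%MS *m P) = \rank (K *m jacobian (chart m A) y).
  by rewrite addsmxMr AyP JP mulmxA addsmx0.
have -> : \rank ((K *m jacobian A y + A y)%MS :&: kermx P)%MS = 1%N.
  transitivity (\rank (A y)); last by rewrite rank_rV Ay0.
  apply/eqmx_rank/andP; split.
    exact: submx_trans (capmxSr _ _) kerP.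
  rewrite sub_capmx addsmxSr/=; exact/sub_kermxP.
by rewrite rA addn1 => -[].
Qed.

End Jacobian.

(** * Coordinates in which [f] and [alpha C] are linear *)

Section Straighten.
Context {R : realType}.

(** The rank condition makes the differential of [(alpha C, f)] at [x] of full column rank, so this
    map can be completed to [Phi]. The matrix [W1] is a section of the linear coordinates [D1] with
    values in the hyperplane orthogonal to [grad f x]. *)
Lemma straighten N r (O : set 'rV[R]_N) x (f : 'rV[R]_N -> R^o)
    (alpha : 'rV[R]_N -> 'rV[R]_N) (C : 'M[R]_(N, r)) :
  open_nbhs x O -> smooth_on O f ->
  (forall j, smooth_on O (fun y => alpha y 0 j : R^o)) -> grad f x != 0 ->
  \rank (kermx (grad f x)^T *m jacobian alpha x *m C) = r ->
  exists (Phi : 'rV[R]_N -> 'rV[R]_N) (W1 : 'M[R]_(r, N)),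
  [/\ forall j, smooth_on O (fun y => Phi y 0 j : R^o),
      forall i j, 'D_(delta_mx 0 i) (fun y => Phi y 0 j : R^o) x = (i == j)%:R,
      forall y, Phi y *m (jacobian alpha x *m C) = alpha y *m C /\
                Phi y *m (grad f x)^T = (f y)%:M &
      W1 *m (jacobian alpha x *m C) = 1%:M /\ W1 *m (grad f x)^T = 0].
Proof.
move=> [oO Ox] sf sa f0 rC.
set xi := grad f x; set D1 := jacobian alpha x *m C.
pose D := row_mx D1 xi^T.
have Dfull : row_full D.
  apply: (@row_full_row_mx _ _ _ _ (kermx xi^T)); first by rewrite mulmxA.
    exact: mulmx_ker.
  by rewrite -trmx0 (inj_eq trmx_inj).
have [W WD] : exists W, W *m D = 1%:M by exists (pinvmx D); rewrite mulVpmx.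
have : W *m D = 1%:M by [].
rewrite -[W in LHS]vsubmxK /D mul_col_row scalar_mx_block => /eq_block_mx[W11 W12 W21 W22].
pose C1 : 'M[R]_(N, r + 1) := row_mx C 0.
pose e1 : 'rV[R]_(r + 1) := row_mx 0 1%:M.
have DE : D = jacobian alpha x *m C1 + xi^T *m e1.
  by rewrite /C1 /e1 !mul_mx_row !mulmx0 mulmx1 add_row_mx addr0 add0r.
(* With [F = (alpha C, f)], whose differential at [x] is [D], this is [Phi y = y + (F y - y D) W]. *)
pose Q1 := 1%:M - D *m W.
pose Q2 := C1 *m W.
pose w := e1 *m W.
pose Phi : 'rV[R]_N -> 'rV[R]_N :=
  fun y => y *m Q1 + alpha y *m Q2 + f y *: w.
have PhiE y : Phi y = y *m Q1 + alpha y *m Q2 + f y *: w by [].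
have PhiD y : Phi y *m D = alpha y *m C1 + f y *: e1.
  rewrite PhiE !mulmxDl -scalemxAl -[_ *m Q2 *m D]mulmxA -[_ *m Q1 *m D]mulmxA.
  have -> : Q1 *m D = 0 by rewrite /Q1 mulmxBl -mulmxA WD mul1mx mulmx1 subrr.
  have -> : Q2 *m D = C1 by rewrite /Q2 -mulmxA WD mulmx1.
  have -> : w *m D = e1 by rewrite /w -mulmxA WD mulmx1.
  by rewrite mulmx0 add0r.
have df : differentiable f x by exact: (sf [::]).
have da : differentiable alpha x by exact: smooth_row_diff sa Ox.
have sPhi j : smooth_on O (fun y => Phi y 0 j : R^o).
  apply/smooth_onP => k.
  have Cf : Ck k O f by exact: smooth_Ck.
  have Ca i : Ck k O (fun y => alpha y 0 i : R^o) by exact: smooth_Ck.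
  have Cid i : Ck k O (fun y : 'rV[R]_N => y 0 i : R^o) by exact: Ck_coord.
  have := CkD oO (CkD oO (Ck_mulmx Q1 oO Cid j) (Ck_mulmx Q2 oO Ca j)) (CkZ oO (w 0 j) Cf).
  by apply: Ck_ext => // y _; rewrite PhiE !mxE [f y * _]mulrC.
exists Phi, (usubmx W); split => //.
  move=> i j; have dPhi : differentiable Phi x by exact: smooth_row_diff sPhi Ox.
  rewrite deriveE; last exact: diff_coord.
  rewrite diff_coordE// -deriveE//.
  suff -> : forall v, 'D_v Phi x = v by rewrite mxE eqxx eq_sym.
  move=> v.
  have d1 : differentiable (fun y : 'rV[R]_N => y *m Q1) x by exact: diff_mulmxr.
  have d2 : differentiable (fun y => alpha y *m Q2) x.
    exact: (differentiable_comp da (diff_mulmxr Q2 (alpha x))).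
  have d3 : differentiable (fun y => f y *: w) x by exact: differentiableZl.
  have d12 : differentiable ((fun y : 'rV[R]_N => y *m Q1) + (fun y => alpha y *m Q2)) x.
    exact: differentiableD.
  rewrite (deriveD (f := (fun y : 'rV[R]_N => y *m Q1) + (fun y => alpha y *m Q2))
    (g := fun y => f y *: w)); [|exact: diff_derivable|exact: diff_derivable].
  rewrite deriveD; [|exact: diff_derivable|exact: diff_derivable].
  rewrite [X in _ + X]deriveE// diffZl// -[X in _ + X *: _]deriveE// diff_grad//.
  rewrite [X in X + _ + _]deriveEjacobian// [X in _ + X + _]deriveEjacobian//.
  rewrite (jacobian_mulmxr (f := id)) ?jacobian_id// jacobian_mulmxr// mul1mx.
  have -> : (v *m xi^T) 0 0 *: w = v *m (xi^T *m w).
    by rewrite mulmxA [v *m xi^T in RHS]mx11_scalar mul_scalar_mx.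
  (* The differential of [Phi] at [x] is [(1 - D W) + D W]. *)
  have Q : Q1 + (jacobian alpha x *m Q2 + xi^T *m w) = 1%:M.
    by rewrite /Q1 /Q2 /w !mulmxA -mulmxDl -DE subrK.
  by rewrite -!mulmxDr -addrA Q mulmx1.
move=> y; have := PhiD y; rewrite /D mul_mx_row /C1 /e1 mul_mx_row scale_row_mx add_row_mx.
by rewrite mulmx0 add0r scaler0 addr0 scalemx1 => /eq_row_mx[].
Qed.

End Straighten.

(** * Constancy of [alpha] on the fibres of [alpha C] in [f = 0] *)

Section Fibres.
Context {R : realType} {N r : nat}.
Variables (O O1 W : set 'rV[R]_N) (x : 'rV[R]_N) (f : 'rV[R]_N -> R^o).
Variables (alpha Phi Psi : 'rV[R]_N -> 'rV[R]_N) (C : 'M[R]_(N, r)).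
Let D1 := jacobian alpha x *m C.
Let xi := grad f x.
Hypothesis O1O : O1 `<=` O.
Hypothesis oW : open W.
Hypothesis sf : smooth_on O f.
Hypothesis sa : forall j, smooth_on O (fun y => alpha y 0 j : R^o).
Hypothesis sPhi : forall j, smooth_on O (fun y => Phi y 0 j : R^o).
Hypothesis sPsi : forall j, smooth_on W (fun y => Psi y 0 j : R^o).
Hypothesis PsiK : forall z, W z -> O1 (Psi z) /\ Phi (Psi z) = z.
Hypothesis PhiD1 : forall y, Phi y *m D1 = alpha y *m C.
Hypothesis Phixi : forall y, Phi y *m xi^T = (f y)%:M.
Hypothesis rkx : \rank (kermx xi^T *m D1) = r.
Hypothesis rk : forall y, O y -> f y = 0 ->
  \rank (kermx (grad f y)^T *m jacobian alpha y) = r.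

(* The rank of [alpha] on [f = 0] equals that of [alpha C], so both have the same critical directions. *)
Lemma derive_fibre z v : W z -> z *m xi^T = 0 -> v *m D1 = 0 -> v *m xi^T = 0 ->
  'D_v (alpha \o Psi) z = 0.
Proof.
move=> Wz zxi vD1 vxi; have [/O1O Oy PPz] := PsiK Wz.
set y := Psi z in Oy PPz.
have dPsi : differentiable Psi z by exact: smooth_row_diff sPsi Wz.
have dPhi : differentiable Phi y by exact: smooth_row_diff sPhi Oy.
have da : differentiable alpha y by exact: smooth_row_diff sa Oy.
have df : differentiable f y by exact: (sf [::]).
have fy : f y = 0.
  by have /matrixP/(_ 0 0) := Phixi y; rewrite PPz zxi !mxE eqxx.
set JS := jacobian Psi z; set JP := jacobian Phi y.
have JSP : JS *m JP = 1%:M.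
  rewrite -jacobian_comp// -(jacobian_id z); apply: near_eq_jacobian.
    by apply: open_near_eq oW _ Wz => u /PsiK[].
  exact: differentiable_comp.
have JPxi : JP *m xi^T = (grad f y)^T.
  have E : (fun u => Phi u *m xi^T) = (fun u => (f u)%:M) by apply/funext.
  exact: (etrans (esym (jacobian_mulmxr xi^T dPhi))
    (etrans (congr1 (fun h => jacobian h y) E) (jacobian_scalar df))).
have JPD1 : JP *m D1 = jacobian alpha y *m C.
  have E : (fun u => Phi u *m D1) = (fun u => alpha u *m C) by apply/funext.
  exact: (etrans (esym (jacobian_mulmxr D1 dPhi))
    (etrans (congr1 (fun h => jacobian h y) E) (jacobian_mulmxr C da))).
have w0 := fibre_linear JSP JPxi JPD1 rkx (rk Oy fy) vD1 vxi.
rewrite deriveEjacobian; last exact: differentiable_comp.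
by rewrite jacobian_comp// mulmxA.
Qed.

End Fibres.

(** In a ball the fibres are convex, being cut out by linear equations; the mean value theorem
    applies along the segment from [z'] to [z]. *)
Lemma fibre_constant (R : realType) (N r : nat) (W : set 'rV[R]_N) (c : 'rV[R]_N) (e : R)
    (H : 'rV[R]_N -> 'rV[R]_N) (D1 : 'M[R]_(N, r)) (xi : 'rV[R]_N) z z' :
  W = ball c e -> (forall j, smooth_on W (fun z => H z 0 j : R^o)) ->
  (forall z v, W z -> z *m xi^T = 0 -> v *m D1 = 0 -> v *m xi^T = 0 -> 'D_v H z = 0) ->
  W z -> W z' -> z *m xi^T = 0 -> z' *m xi^T = 0 -> z *m D1 = z' *m D1 ->
  H z = H z'.
Proof.
move=> WE sH DH Wz Wz' zxi zxi' zD1; apply/rowP => j.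
rewrite WE in Wz Wz'.
have dH u : ball c e u -> differentiable (fun z => H z 0 j : R^o) u.
  by rewrite -WE => Wu; exact: (sH j [::]).
have [t t01 E] := mean_value dH Wz Wz'.
apply/eqP; rewrite -subr_eq0 E.
set u := z' + _; have Wu : W u by rewrite WE; exact: ball_segment.
have dHu : differentiable H u by exact: smooth_row_diff sH Wu.
have k1 : (z - z') *m D1 = 0 by rewrite mulmxBl zD1 subrr.
have k2 : (z - z') *m xi^T = 0 by rewrite mulmxBl zxi zxi' subrr.
have uxi : u *m xi^T = 0 by rewrite mulmxDl -scalemxAl k2 zxi' scaler0 addr0.
have := DH u (z - z') Wu uxi k1 k2.
rewrite derive_mx; last exact: diff_derivable.
by move=> /rowP/(_ j); rewrite !mxE => ->.
Qed.

(** * A cone over a graph is a submanifold *)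

Section ConeOverGraph.
Context {R : realType} {n r : nat}.
Variables (W : set 'rV[R]_n.+2) (H : 'rV[R]_n.+2 -> 'rV[R]_n.+2) (m : 'I_n.+2).
Variables (D1 C : 'M[R]_(n.+2, r)) (W1 : 'M[R]_(r, n.+2)) (xi : 'rV[R]_n.+2).
Variables (X : 'M[R]_n.+2) (V : set 'rV[R]_n.+2).
Hypothesis oW : open W.
Hypothesis sH : forall j, smooth_on W (fun z => H z 0 j : R^o).
Hypothesis Hm : forall z, W z -> H z 0 m = 1.
Hypothesis HC : forall z, W z -> H z *m C = z *m D1.
Hypothesis H_fibre : forall z z', W z -> W z' -> z *m xi^T = 0 ->
  z' *m xi^T = 0 -> z *m D1 = z' *m D1 -> H z = H z'.
Hypothesis W1D1 : W1 *m D1 = 1%:M.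
Hypothesis W1xi : W1 *m xi^T = 0.
Hypothesis XC : \rank (X *m C) = r.
Hypothesis Xm : X *m delta_mx m (0 : 'I_1) = 0.
Hypothesis VE : forall a, V a <->
  a 0 m != 0 /\ exists2 z, W z /\ z *m xi^T = 0 & a = a 0 m *: H z.

(** The directions transverse to the cone: those on which the coordinates [a C] and [a_m] vanish. *)
Let S := kermx (row_mx C (delta_mx m (0 : 'I_1))).

Let sub_S (u : 'rV[R]_n.+2) : (u <= S)%MS <-> u *m C = 0 /\ u 0 m = 0.
Proof.
rewrite sub_kermx mul_mx_row mulmx_delta_col -(row_mx0 _ 1 r 1); split.
  by move=> /eqP/eq_row_mx[-> /matrixP/(_ 0 0)]; rewrite !mxE eqxx mulr1n.
by move=> [-> ->]; rewrite raddf0.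
Qed.

(** The [r] columns of [C] and the [m]-th coordinate are independent, so [S] has dimension
    [n + 2 - (r + 1)], the number of equations expected in dimension [r]. *)
Let rank_S : (r + \rank S = n.+1)%N.
Proof.
have full : row_full (row_mx C (delta_mx m (0 : 'I_1))).
  apply: (row_full_row_mx XC Xm).
  by apply/eqP => /matrixP/(_ m 0)/eqP; rewrite !mxE !eqxx oner_eq0.
have := rank_leq_row (row_mx C (delta_mx m (0 : 'I_1))).
rewrite mxrank_ker; move: full; rewrite /row_full => /eqP ->; lia.
Qed.

Lemma cone_over_graph a0 : V a0 -> submanifold_at r V a0.
Proof.
move=> Va0; have [am0 [z0 [Wz0 z0xi] a0E]] := (VE a0).1 Va0.
(* The parameter of the point of the graph above [a]: moving [z0] along the section [W1] stays in
   [z xi^T = 0] and gives [kap a *m D1 = a C / a_m]. *)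
pose kap (a : 'rV[R]_n.+2) := z0 + ((a 0 m)^-1 *: a - H z0) *m (C *m W1).
have kapa0 : kap a0 = z0.
  by rewrite /kap {2}a0E scalerA mulVf// scale1r subrr mul0mx addr0.
pose G : set 'rV[R]_n.+2 := [set a | a 0 m != 0].
have oG : open G.
  rewrite openE => a Ga; have : {for a, continuous (fun a : 'rV[R]_n.+2 => a 0 m : R)}.
    exact/differentiable_continuous/differentiable_coord.
  by move=> ca; exact: (cvgr_neq0 _ ca Ga).
have Ckap k j : Ck k G (fun a => kap a 0 j : R^o).
  have := CkD oG (Ck_cst oG k (z0 0 j)) (Ck_mulmx (g := fun a => (a 0 m)^-1 *: a - H z0) (C *m W1) oG _ j).
  move=> /(_ _)/Ck_ext; apply => //; first by move=> a _; rewrite /kap [RHS]mxE.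
  move=> i; have := CkB oG (CkM oG (CkV oG (fun a Ga => Ga) (Ck_coord oG k m)) (Ck_coord oG k i)) (Ck_cst oG k (H z0 0 i)).
  by apply: Ck_ext => // a _; rewrite !mxE.
have dkap a : G a -> differentiable kap a.
  by move=> Ga; apply: diff_row => j; exact: Ck_diff (Ckap 0%N j) Ga.
pose O := [set a | G a /\ W (kap a)].
have oO : open O.
  rewrite openE => a [Ga Wa]; apply: filterI; first exact: open_nbhs_nbhs.
  apply: (differentiable_continuous (dkap a Ga)).
  exact: open_nbhs_nbhs.
(* [E] vanishes exactly on [V] and has values in [S]: its coordinates in a basis
   of [S] are the required equations. *)
pose E (a : 'rV[R]_n.+2) : 'rV[R]_n.+2 := a - a 0 m *: H (kap a).
pose P := pinvmx (row_base S).
have SbP : row_base S *m P = 1%:M by rewrite mulmxVp// row_base_free.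
pose g (i : 'I_(\rank S)) (a : 'rV[R]_n.+2) : R^o := (E a *m P) 0 i.
have kapxi a : kap a *m xi^T = 0.
  by rewrite /kap mulmxDl z0xi add0r -!mulmxA W1xi !mulmx0.
have kapD1 a : kap a *m D1 = (a 0 m)^-1 *: (a *m C).
  rewrite /kap mulmxDl -!mulmxA W1D1 mulmx1 mulmxBl HC// -scalemxAl.
  by rewrite addrC subrK.
have ES a : O a -> (E a <= S)%MS.
  move=> [Ga Wa]; apply/sub_S; split.
    by rewrite /E mulmxBl -scalemxAl HC// kapD1 scalerA mulfV// scale1r subrr.
  by rewrite /E !mxE Hm// mulr1 subrr.
have EP a : O a -> E a *m P = 0 -> E a = 0.
  move=> Oa EP0; have : (E a <= row_base S)%MS by rewrite eq_row_base; exact: ES.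
  by move=> /submxP[w Ew]; move: EP0; rewrite Ew -mulmxA SbP mulmx1 => ->; rewrite mul0mx.
have sg i : smooth_on O (g i).
  apply/smooth_onP => k; apply: Ck_mulmx => // j.
  have OG : O `<=` G by move=> a [].
  have CH : Ck k O ((fun z => H z 0 j : R^o) \o kap).
    apply: (@Ck_comp _ _ _ _ O W) => //; first by move=> a [].
      by move=> l; exact: Ck_sub OG (Ckap k l).
    exact: smooth_Ck.
  have := CkB oO (Ck_coord oO k j) (CkM oO (Ck_coord oO k m) CH).
  by apply: Ck_ext => // a _; rewrite /E !mxE.
have Oa0 : O a0 by rewrite /O /= kapa0.
(* Along a direction of [S], [kap] is constant and [E] is affine. *)
have dg i v : (v <= S)%MS -> 'D_v (g i) a0 = (v *m P) 0 i.
  move=> /sub_S[vC vm].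
  have gE (s : R) : g i (a0 + s *: v) = g i a0 + s * (v *m P) 0 i.
    have sm : (a0 + s *: v) 0 m = a0 0 m by rewrite !mxE vm mulr0 addr0.
    have ks : kap (a0 + s *: v) = kap a0.
      rewrite /kap sm; congr (_ + _); rewrite !mulmxA; congr (_ *m _).
      by rewrite !mulmxBl -!scalemxAl mulmxDl -scalemxAl vC scaler0 addr0.
    rewrite /g /E ks sm addrAC mulmxDl -scalemxAl mxE; congr (_ + _).
    by rewrite mxE.
  have dgi : differentiable (g i) (a0 + (0 : R) *: v).
    by rewrite scale0r addr0; exact: (sg i [::]).
  have [_] := derive_comp_curve (is_derive_line a0 v (0 : R^o)) dgi.
  rewrite scale0r addr0 => <-.
  have fe : g i \o (fun s : R^o => a0 + s *: v) = (fun s : R^o => (g i a0 : R^o) + s *: ((v *m P) 0 i : R^o)).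
    by apply/funext => s; exact: gE.
  have [_ D2] := is_derive_line (g i a0) ((v *m P) 0 i : R^o) (0 : R^o).
  exact: (etrans (congr1 (fun h : R^o -> R^o => 'D_(1 : R^o) h (0 : R^o)) fe) D2).
exists (\rank S), O, g; split => //.
(* Along the [l]-th basis vector of [S], the derivative of [g i] is 1 if [i = l] and 0 otherwise, so
   the differentials are independent. *)
- apply/row_freeP; exists (row_base S)^T.
  apply/matrixP => i l; rewrite mxE [RHS]mxE.
  have lS : (row l (row_base S) <= S)%MS.
    by apply: submx_trans (row_sub _ _) _; rewrite eq_row_base.
  have := dg i _ lS; rewrite derive_sum_delta; last exact: (sg i [::]).
  rewrite -row_mul SbP mxE mxE eq_sym => <-.
  by apply: eq_bigr => j _; rewrite !mxE mulrC.
move=> a Oa; have [Ga Wa] := Oa; split.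
  move=> /VE[_ [z [Wz zxi] aE]] i.
  rewrite /g; have -> : E a = 0; last by rewrite mul0mx mxE.
  rewrite /E {1}aE; apply/eqP; rewrite subr_eq0; apply/eqP; congr (_ *: _).
  apply: H_fibre => //.
  by rewrite kapD1 -HC// {2}aE -scalemxAl scalerA mulVf// scale1r.
move=> ga; apply/VE; split => //; exists (kap a) => //.
apply/eqP; rewrite -subr_eq0; apply/eqP/(EP _ Oa)/rowP => i.
by rewrite [LHS]ga mxE.
Qed.

End ConeOverGraph.

Lemma jacobian_chart_m (R : realType) N (m : 'I_N) (A : 'rV[R]_N -> 'rV[R]_N)
    (O : set 'rV[R]_N) x :
  open O -> O x -> (forall y, O y -> A y 0 m != 0) ->
  differentiable (chart m A) x ->
  jacobian (chart m A) x *m delta_mx m (0 : 'I_1) = 0.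
Proof.
move=> oO Ox Am da.
rewrite -(jacobian_mulmxr _ da).
have E y : O y -> chart m A y *m delta_mx m (0 : 'I_1) = ((1 : R^o)%:M : 'rV[R]_1).
  by move=> Oy; rewrite mulmx_delta_col chart_m// Am.
rewrite (near_eq_jacobian (open_near_eq oO E Ox)); last first.
  exact: (differentiable_comp da (diff_mulmxr (delta_mx m (0 : 'I_1)) _)).
rewrite (@jacobian_scalar _ _ (fun=> 1)); last exact: differentiable_cst.
by apply/matrixP => i j; rewrite !mxE derive_cst.
Qed.

Theorem constant_rank (R : realType) n r (O : set 'rV[R]_n.+2) x
    (f : 'rV[R]_n.+2 -> R^o) (A : 'rV[R]_n.+2 -> 'rV[R]_n.+2) (m : 'I_n.+2) :
  open_nbhs x O -> smooth_on O f -> (forall j, smooth_on O (fun y => A y 0 j : R^o)) ->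
  (forall y, O y -> A y 0 m != 0) -> f x = 0 -> grad f x != 0 ->
  (forall y, O y -> f y = 0 ->
     \rank (kermx (grad f y)^T *m jacobian A y + A y)%MS = r.+1) ->
  exists O1, [/\ open_nbhs x O1, O1 `<=` O &
    let V := [set a | exists2 y, O1 y /\ f y = 0 & exists2 k : R, k != 0 & a = k *: A y] in
    forall a, V a -> submanifold_at r V a].
Proof.
move=> nO sf sA Am fx gfx rkA; have [oO Ox] := nO.
pose alpha := chart m A.
have sa j : smooth_on O (fun y => alpha y 0 j : R^o) by exact: smooth_chart.
have rk y : O y -> f y = 0 -> \rank (kermx (grad f y)^T *m jacobian alpha y) = r.
  move=> Oy fy; apply: rank_chart; [exact: smooth_row_diff sA Oy|exact: Am|exact: rkA].
have [C rC] := exists_full_rank_mul (rk x Ox fx).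
have [Phi [W1 [sPhi dPhi PhiE [W1D1 W1xi]]]] := straighten nO sf sa gfx rC.
have [e [Psi [ O1 [e0 [oO1 O1O] K1 K2 sPsi]]]] := inverse_function nO sPhi dPhi.
exists O1; split => // V a.
set W := ball (Phi x) e in K1 K2 sPsi.
have oW : open W by exact: ball_open.
have da y : O y -> differentiable alpha y by move=> Oy; exact: smooth_row_diff sa Oy.
have sPsij j : smooth_on W (fun z => Psi z 0 j : R^o).
  by apply: (sPsi (fun y => y 0 j : R^o)); apply/smooth_onP => k; exact: Ck_coord.
have fPsi z : W z -> z *m (grad f x)^T = (f (Psi z))%:M.
  by move=> Wz; rewrite -(PhiE (Psi z)).2 (K2 z Wz).2.
have fPhi y : f y = 0 -> Phi y *m (grad f x)^T = 0.
  by move=> fy; rewrite (PhiE y).2 fy raddf0.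
have Psi0 z : W z -> z *m (grad f x)^T = 0 -> f (Psi z) = 0.
  move=> Wz zxi; have /matrixP/(_ 0 0) := fPsi z Wz.
  by rewrite zxi !mxE eqxx mulr1n.
(* In the coordinates [Phi], the zero set of [f] is a linear hyperplane and [V] consists of the
   nonzero multiples of [alpha \o Psi] on it. *)
apply: (@cone_over_graph R n r W (alpha \o Psi) m (jacobian alpha x *m C) C W1 (grad f x)
  (kermx (grad f x)^T *m jacobian alpha x)) => //.
- by move=> j; exact: sPsi (sa j).
- by move=> z Wz; apply: chart_m; apply/Am/O1O; have [] := K2 z Wz.
- by move=> z Wz; rewrite /= -(PhiE _).1 (K2 z Wz).2.
- move=> z z' Wz Wz' zxi zxi' zD1.
  apply: (@fibre_constant R n.+2 r W (Phi x) e (alpha \o Psi) (jacobian alpha x *m C)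
    (grad f x) z z') => //.
    by move=> j; exact: sPsi (sa j).
  move=> u v Wu uxi vD1 vxi.
  apply: (@derive_fibre R n.+2 r O O1 W x f alpha Phi Psi C) => //.
    by move=> y; have [] := PhiE y.
    by move=> y; have [] := PhiE y.
  by rewrite mulmxA.
- rewrite -mulmxA (jacobian_chart_m oO Ox Am) ?mulmx0//; exact: da.
move=> b; split.
  move=> [y [ O1y fy] [k k0 ->]]; have Ay := Am _ (O1O _ O1y).
  have [Wy PPy] := K1 _ O1y.
  rewrite mxE mulf_neq0//; split => //; exists (Phi y); first by split => //; exact: fPhi.
  by rewrite /= PPy /alpha /chart scalerA mulfK.
move=> [bm [z [Wz zxi] bE]]; have [ O1z PPz] := K2 z Wz.
exists (Psi z); first by split => //; exact: Psi0.
exists (b 0 m * (A (Psi z) 0 m)^-1).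
  by rewrite mulf_neq0// invr_eq0 Am//; exact: O1O.
by rewrite -scalerA; exact: bE.
Qed.

(** * Isotropic vectors and tangent spaces *)

Section Curves.
Context {R : realType}.

Lemma is_derive_mulmx N M (g : R^o -> 'rV[R]_N) (L : 'M[R]_(N, M)) (t : R^o) v :
  is_derive t 1 g v -> is_derive t 1 (fun s => g s *m L) (v *m L).
Proof.
move=> dg; have dL := @diff_mulmxr R N M L (g t).
have := derive_comp_curve dg dL; rewrite deriveE// diff_lin//.
exact: continuous_mulmxr.
Qed.

Lemma is_derive_coord N (g : R^o -> 'rV[R]_N) (t : R^o) v j :
  is_derive t 1 g v -> is_derive t 1 (fun s => g s 0 j : R^o) (v 0 j : R^o).
Proof.
move=> [dg <-]; split; first by move/derivable_mxP : dg; apply.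
by rewrite derive_mx// mxE.
Qed.

(** The difference quotient at 0 is [k] itself. *)
Lemma is_derive_at0 (V : normedModType R) (a : V) (k : R^o -> V) :
  {for (0 : R^o), continuous k} ->
  is_derive (0 : R^o) 1 (fun t => a + t *: k t) (k 0).
Proof.
move=> ck.
have C : (fun h : R^o => h^-1 *: (((fun t : R^o => a + t *: k t) \o shift (0 : R^o)) (h *: (1 : R^o)) -
    (a + (0 : R^o) *: k 0))) @ 0^' --> k 0.
  have C0 : k @ (0 : R^o)^' --> k 0 by apply/continuous_withinNx.
  apply: cvg_trans C0; apply: near_eq_cvg; near=> h => /=.
  have h0 : h != 0 by near: h; exact: nbhs_dnbhs_neq.
  rewrite scale0r addr0 addr0 addrAC subrr add0r.
  have -> : h *: (1 : R^o) = h by rewrite /GRing.scale/= mulr1.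
  by rewrite scalerA mulVf// scale1r.
split; first by apply/cvg_ex; exists (k 0).
exact: cvg_lim C.
Unshelve. all: by end_near. Qed.

Lemma is_derive_near_cst (V : normedModType R) (g : R^o -> V) (c : V) v :
  is_derive (0 : R^o) 1 g v -> (\forall t \near (0 : R^o), g t = c) -> v = 0.
Proof.
move=> [_ <-] gc; rewrite (near_eq_derive (g := cst c))// derive_cst//.
Qed.

Lemma differentiable_affine (p b : R) (t : R^o) :
  differentiable (fun t : R^o => p + t * b : R^o) t.
Proof.
apply: differentiableD; first exact: differentiable_cst.
by apply: differentiableM => //; exact: differentiable_cst.
Qed.

Lemma near_affine_neq0 (p b : R) : p != 0 -> \forall t \near (0 : R^o), p + t * b != 0.
Proof.
move=> p0; have c0 := differentiable_continuous (differentiable_affine p b (0 : R^o)).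
by apply: (cvgr_neq0 _ c0); rewrite mul0r addr0.
Qed.

End Curves.

(** * The Lorentzian form and the tangent spaces of the absolute *)

Section Form.
Context {R : realType} {n : nat}.
Variable B : 'M[R]_n.+2.
Hypothesis hB : lorentzian_form B.

Lemma formDl x y z : form B (x + y) z = form B x z + form B y z.
Proof. by rewrite /form !mulmxDl mxE. Qed.

Lemma formZl k x z : form B (k *: x) z = k * form B x z.
Proof. by rewrite /form -!scalemxAl mxE. Qed.

Lemma formC x y : form B x y = form B y x.
Proof.
have [sB _] := hB; rewrite /form.
have -> : y *m B *m x^T = (x *m B *m y^T)^T by rewrite !trmx_mul trmxK sB mulmxA.
by rewrite [RHS]mxE.
Qed.

Lemma formDr x y z : form B x (y + z) = form B x y + form B x z.
Proof. by rewrite formC formDl !(formC x). Qed.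

Lemma formZr k x z : form B x (k *: z) = k * form B x z.
Proof. by rewrite formC formZl (formC x). Qed.

Definition formE := (formDl, formDr, formZl, formZr).

Lemma unit_form : B \in unitmx.
Proof.
have [_ [P uP PBP]] := hB.
have : P *m B *m P^T \in unitmx.
  rewrite PBP unitmxE det_diag unitfE; apply/prodf_neq0 => j _.
  by rewrite mxE; case: ifP => _; rewrite ?oppr_eq0 oner_eq0.
by rewrite !unitmx_mul => /andP[/andP[]].
Qed.

Lemma mulmx_form_eq0 (a : 'rV[R]_n.+2) : (a *m B == 0) = (a == 0).
Proof.
apply/idP/idP => [/eqP aB|/eqP ->]; last by rewrite mul0mx.
by rewrite -(mulmxK unit_form a) aB mul0mx.
Qed.

Lemma form_hyperplane (a : 'rV[R]_n.+2) :
  [set v | form B a v = 0] = hyperplane (a *m B).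
Proof.
apply/seteqP; split => v; rewrite /hyperplane /= formC /form.
  move=> av; apply/matrixP => i j; rewrite !ord1 trmx_mul mulmxA hB.1 av mxE//.
by rewrite trmx_mul hB.1 mulmxA => ->; rewrite mxE.
Qed.

(* In coordinates diagonalizing the form, with [l] the negative direction,
   the sum of the squares of the [a_j b_l - b_j a_l] vanishes. *)
Lemma null_orthogonal a b : form B a a = 0 -> form B b b = 0 -> form B a b = 0 ->
  b != 0 -> exists k, a = k *: b.
Proof.
move=> aa bb ab b0; have [_ [P uP PBP]] := hB.
set D := diag_mx _ in PBP.
pose l : 'I_n.+2 := ord_max.
pose co (u : 'rV[R]_n.+2) := u *m invmx P.
have coK u : co u *m P = u by rewrite mulmxKV.
have formco u v : form B u v = \sum_(j | j != l) co u 0 j * co v 0 j - co u 0 l * co v 0 l.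
  rewrite -{1}(coK u) -{1}(coK v) /form trmx_mul !mulmxA -(mulmxA (co u)) -(mulmxA (co u)) PBP.
  rewrite mxE (bigD1 l)//= addrC; congr (_ + _).
    apply: eq_bigr => j jl; rewrite mul_mx_diag !mxE; congr (_ * _).
    by rewrite (negPf jl) mulr1.
  by rewrite mul_mx_diag !mxE eqxx mulrN1 mulNr.
move: aa bb ab; rewrite !formco => aa bb ab.
set s := \sum_(j | _) _ in aa; set t := \sum_(j | _) _ in bb; set w := \sum_(j | _) _ in ab.
have sq : \sum_(j | j != l) (co a 0 j * co b 0 l - co b 0 j * co a 0 l) ^+ 2 = 0.
  transitivity (s * co b 0 l ^+ 2 - 2 * co a 0 l * co b 0 l * w + t * co a 0 l ^+ 2).
    rewrite /s /t /w mulr_sumr !mulr_suml -sumrB -big_split/=.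
    by apply: eq_bigr => j _; ring.
  have -> : s = co a 0 l * co a 0 l by lra.
  have -> : t = co b 0 l * co b 0 l by lra.
  have -> : w = co a 0 l * co b 0 l by lra.
  ring.
have ajbl j : co a 0 j * co b 0 l = co b 0 j * co a 0 l.
  have [->|jl] := eqVneq j l; first by rewrite mulrC.
  have := psumr_eq0P (fun j _ => sqr_ge0 _) sq jl => /eqP.
  by rewrite sqrf_eq0 subr_eq0 => /eqP.
(* Otherwise [(b, b) = 0] is a vanishing sum of squares of the other coordinates, and [b = 0]. *)
have bl : co b 0 l != 0.
  apply: contraNneq b0 => bl0; rewrite -(coK b); suff -> : co b = 0 by rewrite mul0mx.
  apply/rowP => j; rewrite [RHS]mxE; have [->//|jl] := eqVneq j l.
  have t0 : \sum_(j | j != l) (co b 0 j) ^+ 2 = 0.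
    by rewrite bl0 mulr0 subr0 in bb; rewrite -[RHS]bb; apply: eq_bigr => k _; rewrite expr2.
  have := psumr_eq0P (fun j _ => sqr_ge0 _) t0 jl => /eqP.
  by rewrite sqrf_eq0 => /eqP.
set k := co a 0 l / co b 0 l; have E : co a = k *: co b.
  by apply/rowP => j; rewrite [RHS]mxE /k mulrAC [co a 0 l * _]mulrC -ajbl mulfK.
by exists k; rewrite -[LHS]coK E -[in RHS](coK b) -scalemxAl.
Qed.

Lemma is_derive_form (g : R^o -> 'rV[R]_n.+2) (t : R^o) v : is_derive t 1 g v ->
  is_derive t 1 (fun s => form B (g s) (g s) : R^o) (2 * form B (g t) v : R^o).
Proof.
move=> dg.
have dj j : is_derive t 1 ((fun s => (g s *m B) 0 j : R^o) * (fun s => g s 0 j : R^o))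
    ((g t *m B) 0 j *: (v 0 j : R^o) + g t 0 j *: ((v *m B) 0 j : R^o)).
  apply: is_deriveM; last exact: is_derive_coord.
  by apply: is_derive_coord; exact: is_derive_mulmx.
have := is_derive_sum dj.
have -> : \sum_(i < n.+2) ((fun s => (g s *m B) 0 i : R^o) * (fun s => g s 0 i : R^o)) =
    (fun s => form B (g s) (g s) : R^o).
  apply/funext => s; rewrite fct_sumE /form mxE.
  by apply: eq_bigr => j _; rewrite [X in _ = _ * X]mxE.
move=> /is_derive_eq; apply.
rewrite big_split/= [2 * _]mulrDl mul1r {2}formC; congr (_ + _); rewrite /form mxE.
  by apply: eq_bigr => j _; rewrite [X in _ = _ * X]mxE.
by apply: eq_bigr => j _; rewrite [X in _ = _ * X]mxE /GRing.scale/= mulrC.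
Qed.

Lemma tangent_absolute a : absolute B a ->
  tangent_space (absolute B) a = [set v | form B a v = 0].
Proof.
move=> [a0 aa]; apply/seteqP; split => v /=.
  move=> [g [g0 gQ dg]].
  have := is_derive_near_cst (c := 0) (is_derive_form dg).
  rewrite g0 => H; have /eqP : 2 * form B a v = 0.
    by apply: H; near=> t; have [] : absolute B (g t) by near: t.
  by rewrite mulf_eq0 pnatr_eq0/= => /eqP.
move=> av.
have [j aBj] : exists j, (a *m B) 0 j != 0 by apply: row_neq0; rewrite mulmx_form_eq0.
pose w0 : 'rV[R]_n.+2 := delta_mx 0 j.
have aw0 : form B a w0 != 0.
  by rewrite /form /w0 trmx_delta -colE mxE.
(* [w] is isotropic and not orthogonal to [a], so [a + t v + s w] is isotropic for
   a rational function [s = t^2 rho] of [t]. *)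
pose w := w0 - (form B w0 w0 / (2 * form B a w0)) *: a.
have aw : form B a w = form B a w0.
  by rewrite /w -scaleNr !formE aa mulr0 addr0.
have ww : form B w w = 0.
  rewrite /w -scaleNr !formE aa (formC w0 a); field; exact: aw0.
clearbody w.
pose q := form B v v; pose p := form B a w; pose b := form B v w.
have p0 : p != 0 by rewrite /p aw.
(* Solves [t^2 q + 2 s (p + t b) = 0], the isotropy condition, for [s = t^2 rho]. *)
pose rho (t : R^o) : R^o := - q / (2 * (p + t * b)).
pose k (t : R^o) : 'rV[R]_n.+2 := v + (t * rho t) *: w.
have ck : {for (0 : R^o), continuous k}.
  apply: differentiable_continuous; apply: differentiableD; first exact: differentiable_cst.
  apply: differentiableZl; apply: differentiableM => //.
  apply: differentiableM; first exact: differentiable_cst.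
  apply: differentiableV; last by rewrite mul0r addr0 mulf_neq0// pnatr_eq0.
  by apply: differentiableM; [exact: differentiable_cst|exact: differentiable_affine].
have k0 : k 0 = v by rewrite /k mul0r scale0r addr0.
exists (fun t => a + t *: k t); split; first by rewrite scale0r addr0.
  have pt0 := near_affine_neq0 b p0.
  near=> t; have pt : p + t * b != 0 by near: t.
  have wt : form B (a + t *: k t) w = p + t * b.
    by rewrite /k !formE ww -/p -/b; ring.
  split.
    by apply: contraNneq pt => E; rewrite -wt E /form !mul0mx mxE.
  rewrite /k !formE aa av (formC v a) av (formC w a) (formC w v) ww -/p -/b -/q /rho.
  by field.
by rewrite -[X in is_derive _ _ _ X]k0; exact: is_derive_at0.
Unshelve. all: by end_near. Qed.

End Form.

(** * Local equations and lifts of the Gauss map *)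

Section GaussMap.
Context {R : realType} {n : nat}.
Implicit Types (U O : set 'rV[R]_n.+2) (x xi eta : 'rV[R]_n.+2).

Lemma hyperplane_sub xi eta : hyperplane xi `<=` hyperplane eta ->
  exists k, eta = k *: xi.
Proof.
move=> sub; apply/sub_rVP; rewrite submxE.
suff /(congr1 trmx) : (cokermx xi)^T *m eta^T = 0.
  by rewrite trmx_mul !trmxK trmx0 => ->.
apply/row_matrixP => i; rewrite row0 row_mul; apply: sub.
by rewrite /hyperplane/= -row_mul -trmx_mul mulmx_coker trmx0 row0.
Qed.

Lemma hyperplaneZ (k : R) xi : k != 0 -> hyperplane (k *: xi) = hyperplane xi.
Proof.
move=> k0; apply/seteqP; split => v; rewrite /hyperplane/= linearZ -scalemxAr.
  by move/eqP; rewrite scaler_eq0 (negPf k0) => /eqP.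
by move=> ->; rewrite scaler0.
Qed.

Lemma hyperplane_inj xi eta : hyperplane xi = hyperplane eta -> eta != 0 ->
  exists2 k, k != 0 & eta = k *: xi.
Proof.
move=> E eta0; have [|k Ek] := @hyperplane_sub xi eta; first by rewrite E.
by exists k => //; apply: contraNneq eta0 => k0; rewrite Ek k0 scale0r.
Qed.

Lemma smooth_row N M (O : set 'rV[R]_N) (f : 'rV[R]_N -> 'rV[R]_M) : open O ->
  (forall j, smooth_on O (fun y => f y 0 j : R^o)) -> smooth_on O f.
Proof.
move=> oO sf; apply/smooth_onP => k.
have {}sf j : Ck k O (fun y => f y 0 j : R^o) by exact: smooth_Ck.
elim: k f sf => [|k IH] f sf; split => //.
- by move=> y Oy; apply: diff_row => j; exact: Ck_diff (sf j) Oy.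
- by move=> y Oy; apply: diff_row => j; exact: Ck_diff (sf j) Oy.
move=> v; apply: IH => j; have [_ /(_ v)] := sf j; apply: Ck_ext => // y Oy.
rewrite derive_mx ?mxE//; apply: diff_derivable.
by apply: diff_row => i; exact: Ck_diff (sf i) Oy.
Qed.

Lemma smooth_grad N (O : set 'rV[R]_N) (f : 'rV[R]_N -> R^o) : open O ->
  smooth_on O f -> forall j, smooth_on O (fun y => grad f y 0 j : R^o).
Proof.
move=> oO /smooth_onP sf j; apply/smooth_onP => k.
have [_ /(_ (delta_mx 0 j))] := sf k.+1; apply: Ck_ext => // y _.
by rewrite mxE.
Qed.

Lemma open_neq0_at N (O : set 'rV[R]_N) (f : 'rV[R]_N -> R^o) (x : 'rV[R]_N) :
  open_nbhs x O -> (forall y, O y -> differentiable f y) -> f x != 0 ->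
  open_nbhs x [set y | O y /\ f y != 0].
Proof.
move=> [oO Ox] df fx; split => //.
rewrite openE => y [Oy fy]; apply: filterI; first exact: open_nbhs_nbhs.
exact: (cvgr_neq0 _ (differentiable_continuous (df y Oy)) fy).
Qed.

(** The codimension is 1, so a single equation remains; the neighbourhood is shrunk until one
    coordinate of its gradient does not vanish. *)
Lemma local_equation U x O' : regular U x -> nbhs x O' ->
  exists O (f : 'rV[R]_n.+2 -> R^o), [/\ open_nbhs x O, O `<=` O', smooth_on O f,
    (forall y, O y -> grad f y != 0) & (forall y, O y -> (U y <-> f y = 0))].
Proof.
move=> [c [ O [f [nc [Ux nO] sf fr UE]]]] nO'.
have c1 : c = 1%N by lia.
subst c.
have gE : \matrix_(i < 1, j < n.+2) 'D_(delta_mx 0 j) (f i) x = grad (f 0) x.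
  by apply/rowP => j; rewrite !mxE.
have g0 : grad (f 0) x != 0.
  by rewrite -gE -mxrank_eq0; move: fr; rewrite /row_free => /eqP ->.
have [j gj] := row_neq0 g0.
have nO2 : open_nbhs x (O `&` O'°).
  apply: open_nbhsI => //; split; first exact: open_interior.
  exact: nbhs_singleton (nbhs_interior nO').
have sD : forall y, (O `&` O'°) y -> differentiable (fun y => grad (f 0) y 0 j : R^o) y.
  by move=> y [Oy _]; exact: (smooth_grad nO.1 (sf 0) j [::]).
exists [set y | (O `&` O'°) y /\ grad (f 0) y 0 j != 0], (f 0); split.
- exact: open_neq0_at nO2 sD gj.
- by move=> y [[_ /interior_subset]].
- by move=> vs y [[Oy _] _]; exact: sf.
- by move=> y [_]; apply: contraNneq => ->; rewrite mxE.
move=> y [[Oy _] _]; split => [/(UE y Oy)//|fy].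
by apply/(UE y Oy) => i; rewrite ord1.
Qed.

Lemma regular_local U O (f : 'rV[R]_n.+2 -> R^o) y : open O -> smooth_on O f ->
  (forall y, O y -> grad f y != 0) -> (forall y, O y -> (U y <-> f y = 0)) ->
  O y -> U y -> regular U y.
Proof.
move=> oO sf g0 UE Oy Uy; exists 1%N, O, (fun=> f); split => //; first by rewrite addn1.
  have -> : \matrix_(i < 1, j < n.+2) 'D_(delta_mx 0 j) f y = grad f y.
    by apply/rowP => j; rewrite !mxE.
  by rewrite /row_free rank_rV g0.
by move=> z Oz; split => [/(UE z Oz)//|/(_ 0)/(UE z Oz)].
Qed.

Lemma tangent_sub_grad U O (f : 'rV[R]_n.+2 -> R^o) y : open O -> smooth_on O f ->
  (forall y, O y -> (U y <-> f y = 0)) -> O y ->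
  tangent_space U y `<=` hyperplane (grad f y).
Proof.
move=> oO sf UE Oy v [g [g0 Ug dg]].
have df : differentiable f y by exact: (sf [::]).
have df0 : differentiable f (g 0) by rewrite g0.
have Og : \forall t \near (0 : R^o), O (g t).
  by apply: is_derive_near dg _; rewrite g0; exact: open_nbhs_nbhs.
have := is_derive_near_cst (c := 0) (derive_comp_curve dg df0).
rewrite g0 diff_grad// => H; apply/matrixP => i j; rewrite !ord1 [RHS]mxE.
apply: H; near=> t; apply/UE; last by near: t.
by near: t.
Unshelve. all: by end_near. Qed.

(** Modulo [xi x] the lift vanishes along the line of direction [u], hence so does its
    derivative. *)
Lemma jacobian_along O (xi : 'rV[R]_n.+2 -> 'rV[R]_n.+2) x u :
  (forall j, smooth_on O (fun y => xi y 0 j : R^o)) -> O x ->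
  (\forall t \near (0 : R^o), exists k, xi (x + t *: u) = k *: xi x) ->
  (u *m jacobian xi x <= xi x)%MS.
Proof.
move=> sxi Ox H; rewrite submxE.
have dxi : differentiable xi x by exact: smooth_row_diff sxi Ox.
have dxi0 : differentiable xi (x + (0 : R^o) *: u) by rewrite scale0r addr0.
have := derive_comp_curve (is_derive_line x u (0 : R^o)) dxi0.
rewrite scale0r addr0 deriveEjacobian// => D.
have := is_derive_near_cst (c := 0) (is_derive_mulmx (cokermx (xi x)) D).
move=> ->//; near=> t; have [k Ek] : exists k, xi (x + t *: u) = k *: xi x by near: t.
by rewrite /= Ek -scalemxAl mulmx_coker scaler0.
Unshelve. all: by end_near. Qed.

(** Used in both directions, it shows that the rank of the Gauss map does not depend on the lift. *)
Lemma gauss_rank_le_lift U O (xi xi' : 'rV[R]_n.+2 -> 'rV[R]_n.+2) x :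
  open_nbhs x O -> differentiable xi x -> differentiable xi' x -> U x ->
  (forall y, O y -> U y -> xi y != 0 /\ tangent_space U y = hyperplane (xi y)) ->
  (forall y, O y -> U y -> xi' y != 0 /\ tangent_space U y = hyperplane (xi' y)) ->
  (kermx (xi x)^T *m jacobian xi x + xi x <= kermx (xi' x)^T *m jacobian xi' x + xi' x)%MS.
Proof.
move=> nO dxi dxi' Ux T T'; have [oO Ox] := nO.
have prop y : O y -> U y -> exists2 k, k != 0 & xi y = k *: xi' y.
  move=> Oy Uy; have [xi0 Ty] := T y Oy Uy; have [_ Ty'] := T' y Oy Uy.
  by apply: hyperplane_inj => //; rewrite -Ty -Ty'.
have [mu mu0 Emu] := prop x Ox Ux.
rewrite addsmx_sub; apply/andP; split; last first.
  by rewrite Emu; apply: scalemx_sub; exact: addsmxSr.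
apply/rV_subP => u /submxP[w Ew].
set v := w *m kermx (xi x)^T.
have vxi : v *m (xi x)^T = 0 by rewrite /v -mulmxA mulmx_ker mulmx0.
have vxi' : v *m (xi' x)^T = 0.
  by move: vxi; rewrite Emu linearZ -scalemxAr => /eqP; rewrite scaler_eq0 (negPf mu0) => /eqP.
(* The lifts are comparable on [U] only, so the tangent vector [v] is realized by a curve in [U]. *)
have [g [g0 Ug dg]] : tangent_space U x v by rewrite (T x Ox Ux).2.
have dxi0 : differentiable xi (g 0) by rewrite g0.
have dxi'0 : differentiable xi' (g 0) by rewrite g0.
have := derive_comp_curve dg dxi0; rewrite g0 deriveEjacobian// => dp.
have := derive_comp_curve dg dxi'0; rewrite g0 deriveEjacobian// => dp'.
have uE : u = v *m jacobian xi x by rewrite /v -mulmxA.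
set u' := v *m jacobian xi' x in dp'; rewrite -uE in dp.
have Og : \forall t \near (0 : R^o), O (g t).
  by apply: is_derive_near dg _; rewrite g0; exact: open_nbhs_nbhs.
have [j xj] := row_neq0 (T' x Ox Ux).1.
(* The lifts are proportional along [g]: differentiate [xi_i xi'_j = xi_j xi'_i]. *)
have E i : xi x 0 i * u' 0 j + xi' x 0 j * u 0 i = xi x 0 j * u' 0 i + xi' x 0 i * u 0 j.
  have d1 := is_deriveM (is_derive_coord i dp) (is_derive_coord j dp').
  have d2 := is_deriveM (is_derive_coord j dp) (is_derive_coord i dp').
  have := derive_val (is_derive := d1).
  rewrite (near_eq_derive (g := (fun t => (xi \o g) t 0 j : R^o) * (fun t => (xi' \o g) t 0 i : R^o))).
    by rewrite (derive_val (is_derive := d2)) /GRing.scale/= g0 => <-.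
  near=> t; have Ogt : O (g t) by near: t.
  have Ugt : U (g t) by near: t.
  have [k _ Ek] := prop _ Ogt Ugt.
  by rewrite /GRing.mul/= Ek !mxE -!mulrA; congr (_ * _); rewrite mulrC.
have -> : u = mu *: u' + ((u 0 j - mu * u' 0 j) / xi' x 0 j) *: xi' x.
  apply/rowP => i; have := E i; rewrite Emu ![(mu *: xi' x) 0 _]mxE => Ei.
  rewrite [RHS]mxE [X in _ = X + _]mxE [X in _ = _ + X]mxE.
  have -> : u 0 i = (mu * xi' x 0 j * u' 0 i + xi' x 0 i * u 0 j - mu * xi' x 0 i * u' 0 j) / xi' x 0 j.
    by apply: (canRL (mulfK xj)); lra.
  by field.
apply: addmx_sub_adds; apply: scalemx_sub => //.
by apply: submxMr; rewrite sub_kermx; exact/eqP.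
Unshelve. all: by end_near. Qed.

End GaussMap.

(** * Lightlike hypersurfaces *)

(** Modulo [xi], the map [J] on the hyperplane of dimension [n + 1] kills the plane of [x] and [a],
    so its rank is at most [n - 1]; [xi] itself adds 1. *)
Lemma rank_kermx_addsmx_le (F : fieldType) n (xi x a : 'rV[F]_n.+2) (J : 'M[F]_n.+2) :
  xi != 0 -> x *m xi^T = 0 -> a *m xi^T = 0 -> \rank (x + a)%MS = 2%N ->
  (x *m J <= xi)%MS -> (a *m J <= xi)%MS ->
  (\rank (kermx xi^T *m J + xi)%MS <= n)%N.
Proof.
move=> xi0 xxi axi rxa xJ aJ; set K := kermx xi^T; set Z := cokermx xi.
have rxi : \rank xi = 1%N by rewrite rank_rV xi0.
have rK : \rank K = n.+1 by rewrite mxrank_ker mxrank_tr rxi subn1.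
have rZ : \rank (kermx Z) = 1%N by rewrite mxrank_ker mxrank_coker rxi; lia.
have r1 := mxrank_mul_ker K (J *m Z).
have r2 := mxrank_mul_ker (K *m J + xi)%MS Z.
have le2 : (2 <= \rank (K :&: kermx (J *m Z))%MS)%N.
  have kill (u : 'rV[F]_n.+2) : u *m xi^T = 0 -> (u *m J <= xi)%MS ->
      (u <= K :&: kermx (J *m Z))%MS.
    move=> uxi uJ; rewrite sub_capmx; apply/andP; split; apply/sub_kermxP => //.
    by rewrite mulmxA; apply/eqP; rewrite -submxE.
  have sub : (x + a <= K :&: kermx (J *m Z))%MS by rewrite addsmx_sub !kill.
  by apply: leq_trans (mxrankS sub); rewrite rxa.
have le1 : (\rank ((K *m J + xi)%MS :&: kermx Z)%MS <= 1)%N.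
  by apply: leq_trans (mxrankS (capmxSr _ _)) _; rewrite rZ.
have rE : \rank ((K *m J + xi)%MS *m Z) = \rank (K *m (J *m Z)).
  by rewrite addsmxMr /Z mulmx_coker addsmx0 mulmxA.
lia.
Qed.

Section Lightlike.
Context {R : realType} {n : nat}.
Variables (B : 'M[R]_n.+2) (U : set 'rV[R]_n.+2).
Hypothesis hB : lorentzian_form B.
Hypothesis hU : lightlike_hypersurface B U.
(** The line is cut with the de Sitter space, which contains [U] but not the point [a] of the
    absolute. *)
Hypothesis hline : forall x a, regular U x -> tangency_point B U x a ->
  proj_line x a `&` de_sitter B `<=` U.

Let Uds : U `<=` de_sitter B. Proof. by have [[]] := hU. Qed.

Let regU x : regular U x -> U x.
Proof. by move=> [c [ O [f [_ []]]]]. Qed.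

Lemma tangencyE x a : tangency_point B U x a -> tangent_space U x = hyperplane (a *m B).
Proof. by move=> [aQ ->]; rewrite tangent_absolute// form_hyperplane. Qed.

Lemma tangency_form x a v : tangency_point B U x a ->
  tangent_space U x v <-> form B a v = 0.
Proof. by move=> [aQ ->]; rewrite tangent_absolute. Qed.

(** The contact point is the pole of the tangent hyperplane; the given [b] guarantees that this pole
    is isotropic. *)
Lemma tangencyP y xi : (exists b, tangency_point B U y b) -> xi != 0 ->
  tangent_space U y = hyperplane xi ->
  forall a, tangency_point B U y a <-> exists2 k, k != 0 & a = k *: (xi *m invmx B).
Proof.
move=> [b tb] xi0 Ty.
have uB := unit_form hB.
have prop a : tangency_point B U y a -> exists2 k, k != 0 & a = k *: (xi *m invmx B).
  move=> ta; have [||k k0 E] := @hyperplane_inj _ _ xi (a *m B).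
  - by rewrite -Ty; exact: tangencyE.
  - by have [[a0 _] _] := ta; rewrite (mulmx_form_eq0 hB).
  by exists k => //; rewrite scalemxAl -E mulmxK.
move=> a; split; first exact: prop.
have [k' k'0 bE] := prop b tb; move=> [k k0 ->].
have [[b0 bb] _] := tb.
have aE : k *: (xi *m invmx B) = (k / k') *: b by rewrite bE scalerA divfK.
have aQ : absolute B (k *: (xi *m invmx B)).
  rewrite aE; split; first by rewrite scaler_eq0 negb_or b0 mulf_neq0 ?invr_eq0.
  by rewrite !(formZl, formZr hB) bb !mulr0.
split => //; rewrite tangent_absolute// form_hyperplane// -scalemxAl mulmxKV//.
by rewrite hyperplaneZ.
Qed.

(** [U] is a cone, so the radial direction [x] is tangent to it. *)
Lemma form_tangency x a : regular U x -> tangency_point B U x a -> form B a x = 0.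
Proof.
move=> rx ta; apply/(tangency_form x ta).
have [[_ projU _ _] _] := hU.
exists (fun h : R^o => x + h *: x); split; first by rewrite scale0r addr0.
  near=> h; have [_] := projU x (regU rx).
  rewrite -{2}(scale1r x) -scalerDl -[h]mulr1; apply.
  by near: h; exact/near_affine_neq0/oner_neq0.
exact: is_derive_line.
Unshelve. all: by end_near. Qed.

(** Since [a] is isotropic and orthogonal to [x], the square of [s x + t a] is [s^2 (x, x)], which
    is positive. *)
Lemma generator_sub x a s t : regular U x -> tangency_point B U x a -> s != 0 ->
  U (s *: x + t *: a).
Proof.
move=> rx ta s0; apply: (hline rx ta); split; first by exists s, t.
have [[a0 aa] _] := ta; have ax := form_tangency rx ta.
have E : form B (s *: x + t *: a) (s *: x + t *: a) = s ^+ 2 * form B x x.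
  by rewrite !(formDl, formZl, formDr hB, formZr hB) aa (formC hB x a) ax; ring.
rewrite /de_sitter/= E mulr_gt0//; last exact/Uds/regU.
by rewrite exprn_even_gt0.
Qed.

(** The form is constant along [x + s a], so normalization divides by a constant and the velocity is
    a multiple of [a]. *)
Lemma isotropic_generator x a : regular U x -> tangency_point B U x a ->
  isotropic_line B x a.
Proof.
move=> rx ta t; have [[a0 aa] _] := ta; have ax := form_tangency rx ta.
have xx : 0 < form B x x by exact/Uds/regU.
set c := (Num.sqrt (form B x x))^-1.
have c0 : c != 0 by rewrite invr_eq0 sqrtr_eq0 -ltNge.
have -> : (fun s : R^o => normalize B (x + s *: a)) = (fun s => c *: x + s *: (c *: a)).
  apply/funext => s; rewrite /normalize.
  have -> : form B (x + s *: a) (x + s *: a) = form B x x.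
    by rewrite !(formDl, formZl, formDr hB, formZr hB) aa (formC hB x a) ax !mulr0 !addr0.
  by rewrite -/c scalerDr !scalerA (mulrC c).
exists (c *: a); split; first exact: is_derive_line.
  by rewrite scaler_eq0 negb_or c0.
by rewrite !(formZl, formZr hB) aa !mulr0.
Qed.

Lemma tangent_generator x a y : regular U x -> tangency_point B U x a ->
  proj_line x a y -> regular U y -> tangent_space U y = tangent_space U x.
Proof.
move=> rx ta [s [t yE]] ry; have [[a0 aa] _] := ta.
have ax := form_tangency rx ta.
(* For [s = 0] the point [y] would be a multiple of [a], of square 0. *)
have s0 : s != 0.
  apply/eqP => s0; have := Uds (regU ry); rewrite yE s0 scale0r add0r /de_sitter/=.
  by rewrite !(formZl, formZr hB) aa !mulr0 ltxx.
have [b tb] := hU.2 y ry.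
have ba : form B b a = 0.
  apply/(tangency_form a tb).
  exists (fun h : R^o => y + h *: a); split; first by rewrite scale0r addr0.
    near=> h; rewrite yE -addrA -scalerDl; exact: generator_sub.
  exact: is_derive_line.
have [[b0 bb] _] := tb.
have [k ak] : exists k, a = k *: b by apply: (null_orthogonal hB) => //; rewrite formC.
have k0 : k != 0 by apply: contraNneq a0 => k0; rewrite ak k0 scale0r.
by rewrite (tangencyE tb) (tangencyE ta) ak -scalemxAl hyperplaneZ.
Unshelve. all: by end_near. Qed.

(** The tangent space is already known to be a hyperplane, the polar of the contact point; its
    inclusion in the kernel of [grad f x] is thus an equality. *)
Lemma tangent_grad x O (f : 'rV[R]_n.+2 -> R^o) : open O -> smooth_on O f ->
  (forall y, O y -> grad f y != 0) -> (forall y, O y -> (U y <-> f y = 0)) ->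
  O x -> U x -> tangent_space U x = hyperplane (grad f x).
Proof.
move=> oO sf g0 UE Ox Ux.
have [a ta] := hU.2 x (regular_local oO sf g0 UE Ox Ux).
have := tangent_sub_grad oO sf UE Ox; rewrite (tangencyE ta) => /hyperplane_sub[k kE].
rewrite kE hyperplaneZ//; apply: contraNneq (g0 _ Ox) => k0.
by rewrite kE k0 scale0r.
Qed.

Lemma lightlike_degenerate : tangentially_degenerate U.
Proof.
move=> x rx; have [a ta] := hU.2 x rx.
have [ O [f [nO _ sf g0 UE]]] := local_equation rx filterT.
have [oO Ox] := nO.
have sg := smooth_grad oO sf.
have T y : O y -> U y -> grad f y != 0 /\ tangent_space U y = hyperplane (grad f y).
  by move=> Oy Uy; split; [exact: g0|exact: (tangent_grad oO)].
have [[a0 aa] _] := ta; have ax := form_tangency rx ta.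
have along u : proj_line x a u -> (u *m jacobian (grad f) x <= grad f x)%MS.
  move=> [s [t uE]]; apply: (jacobian_along sg Ox); near=> h.
  have xhu : x + h *: u = (1 + h * s) *: x + (h * t) *: a.
    by rewrite uE scalerDr !scalerA scalerDl scale1r addrA.
  have hs : 1 + h * s != 0.
    by near: h; exact/near_affine_neq0/oner_neq0.
  have Oxh : O (x + h *: u).
    near: h; apply: is_derive_near (is_derive_line x u 0) _.
    by rewrite scale0r addr0; exact: open_nbhs_nbhs.
  have Uxh : U (x + h *: u) by rewrite xhu; exact: generator_sub.
  have rxh := regular_local oO sf g0 UE Oxh Uxh.
  have line : proj_line x a (x + h *: u) by exists (1 + h * s), (h * t).
  have := tangent_generator rx ta line rxh.
  rewrite (T _ Oxh Uxh).2 (T _ Ox (regU rx)).2 => E.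
  have [|k _ ->] := @hyperplane_inj _ _ (grad f x) (grad f (x + h *: u)) _ (g0 _ Oxh).
    by rewrite E.
  by exists k.
have xx : 0 < form B x x by exact/Uds/regU.
have gT v : form B a v = 0 -> v *m (grad f x)^T = 0.
  by move=> /(tangency_form v ta); rewrite (T _ Ox (regU rx)).2.
have rle : (\rank (kermx (grad f x)^T *m jacobian (grad f) x + grad f x)%MS <= n)%N.
  apply: (@rank_kermx_addsmx_le _ _ _ x a) => //.
  - exact: g0.
  - exact: gT.
  - exact: gT.
  (* [x] and [a] are independent because [(x, x) > 0] while [(a, a) = 0]. *)
  - rewrite mxrank_disjoint_sum ?rank_rV ?a0; first last.
      apply/eqP; rewrite -submx0; apply/rV_subP => u; rewrite sub_capmx.
      move=> /andP[/sub_rVP[k uk] /sub_rVP[l ul]].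
      have : form B u u = k * k * form B x x by rewrite uk !(formZl, formZr hB) mulrA.
      rewrite ul !(formZl, formZr hB) aa !mulr0 => /esym/eqP; rewrite !mulf_eq0 orbb.
      by rewrite (gt_eqF xx) orbF => /eqP k0; rewrite -ul uk k0 scale0r sub0mx.
    by rewrite (_ : x != 0)//; apply: contraTneq xx => ->; rewrite /form !mul0mx mxE ltxx.
  - by apply: along; exists 1, 0; rewrite scale1r scale0r addr0.
  - by apply: along; exists 0, 1; rewrite scale1r scale0r add0r.
have rge : (0 < \rank (kermx (grad f x)^T *m jacobian (grad f) x + grad f x)%MS)%N.
  by apply: leq_trans (mxrankS (addsmxSr _ _)); rewrite rank_rV g0.
(* The rank counts the line of [grad f x] as well: it equals [r + 1], so the bound by [n] reads
   [r < n]. *)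
move: rle rge; case E : (\rank _) => [//|r] rn _.
exists r => //; exists O, (grad f); split => //.
exact: smooth_row.
Unshelve. all: by end_near. Qed.

Lemma tangency_locus_submanifold r : gauss_rank U r -> tangency_locus_dim B U r.
Proof.
move=> gr x rx O' nO'; have uB := unit_form hB.
have [ O [f [nO OO' sf g0 UE]]] := local_equation rx nO'.
have [oO Ox] := nO.
have sg := smooth_grad oO sf.
have T y : O y -> U y -> grad f y != 0 /\ tangent_space U y = hyperplane (grad f y).
  by move=> Oy Uy; split; [exact: g0|exact: (tangent_grad oO)].
have reg y : O y -> U y -> regular U y := regular_local oO sf g0 UE (y := y).
(* The rank, given through an arbitrary lift near [y], is transferred to the lift [grad f]. *)
have rk y : O y -> f y = 0 ->
    \rank (kermx (grad f y)^T *m jacobian (grad f) y + grad f y)%MS = r.+1.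
  move=> Oy fy; have Uy : U y by apply/UE.
  have [P [xi [nP sxi Txi <-]]] := gr y (reg y Oy Uy).
  have nPO : open_nbhs y (P `&` O) by exact: open_nbhsI.
  have dg : differentiable (grad f) y by exact: smooth_row_diff sg Oy.
  have dxi : differentiable xi y by apply: (sxi [::]); have [] := nP.
  have T1 z : (P `&` O) z -> U z -> grad f z != 0 /\ tangent_space U z = hyperplane (grad f z).
    by move=> [_ Oz]; exact: T.
  have T2 z : (P `&` O) z -> U z -> xi z != 0 /\ tangent_space U z = hyperplane (xi z).
    by move=> [Pz _]; exact: Txi.
  apply/eqP; rewrite eqn_leq; apply/andP; split; apply: mxrankS.
    exact: gauss_rank_le_lift T1 T2.
  exact: gauss_rank_le_lift T2 T1.
pose A y := grad f y *m invmx B.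
have sA j : smooth_on O (fun y => A y 0 j : R^o).
  by apply/smooth_onP => k; apply: Ck_mulmx => // i; exact: smooth_Ck.
have Ax : A x != 0.
  by apply: contraNneq (g0 x Ox) => A0; rewrite -(mulmxKV uB (grad f x)) -/(A x) A0 mul0mx.
have [m Axm] := row_neq0 Ax.
have nO2 := open_neq0_at nO (fun y Oy => sA m [::] y Oy) Axm.
have [|||||y [Oy _] fy|O1 [nO1 O1O VE]] := @constant_rank R n r _ x f A m nO2.
- by move=> vs y [Oy _]; exact: sf.
- by move=> j vs y [Oy _]; exact: sA.
- by move=> y [].
- exact/(UE x Ox)/regU.
- exact: g0.
(* Passing from [grad f] to its pole multiplies by the invertible matrix [invmx B], which preserves
   the rank. *)
- rewrite -(rk y Oy fy) /A jacobian_mulmxr; last exact: smooth_row_diff sg Oy.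
  rewrite mulmxA -addsmxMr mxrankMfree//.
  by rewrite row_free_unit unitmx_inv.
exists O1; split => //; first by move=> y /O1O[/OO'].
have -> : tangency_locus B U O1 =
    [set a | exists2 y, O1 y /\ f y = 0 & exists2 k : R, k != 0 & a = k *: A y].
  have tP y : O1 y -> f y = 0 -> forall a, tangency_point B U y a <-> exists2 k, k != 0 & a = k *: A y.
    move=> /O1O[Oy _] fy; have Uy : U y by apply/UE.
    by apply: tangencyP (T y Oy Uy).1 (T y Oy Uy).2; exact/hU.2/reg.
  apply/seteqP; split => a /=.
    move=> [y [ry O1y] ta]; have [Oy _] := O1O _ O1y.
    have fy : f y = 0 by apply/(UE y Oy)/regU.
    by exists y => //; apply/tP.
  move=> [y [ O1y fy] ka]; have [Oy _] := O1O _ O1y.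
  exists y; last by apply/tP.
  by split => //; apply: reg => //; exact/UE.
exact: VE.
Qed.

End Lightlike.

Theorem theorem2 (R : realType) (n : nat) (B : 'M[R]_n.+2)
  (U : set 'rV[R]_n.+2)
  (hB : lorentzian_form B)
  (hU : lightlike_hypersurface B U)
  (hline : forall x a, regular U x -> tangency_point B U x a ->
     proj_line x a `&` de_sitter B `<=` U) :
  [/\ (forall x, regular U x -> exists a,
         [/\ tangency_point B U x a,
             isotropic_line B x a
           & proj_line x a `&` de_sitter B `<=` U]),
      (forall x a y, regular U x -> tangency_point B U x a ->
         proj_line x a y -> regular U y ->
         tangent_space U y = tangent_space U x),
      tangentially_degenerate U
    & forall r, gauss_rank U r -> tangency_locus_dim B U r].
Proof.
split.
- move=> x rx; have [a ta] := hU.2 x rx; exists a; split => //; last exact: hline.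
  exact: (isotropic_generator hB hU).
- move=> x a y rx ta; exact: (tangent_generator hB hU hline rx ta).
- exact: (lightlike_degenerate hB hU hline).
- move=> r; exact: (tangency_locus_submanifold hB hU).
Qed.
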